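(* Let $\epsilon>0$ be arbitrary and let $$f_{dm}(x):=\begin{cases}-\frac{2}{\pi}\log\left(e^{-\frac{\pi}{2}x}-1\right) & \text{if } x\in\left[-\frac{2}{\pi}\log 2,\,0\right),\\[2pt] -\frac{2}{\pi}\log\left(1-e^{-\frac{\pi}{2}x}\right) & \text{if } x>0.\end{cases}$$ Then $$\lim_{n\to\infty}\frac{1}{dm(n)}\cdot\#\left\{\lambda\in\mathscr{D}_m(n):\widetilde{\varphi}(\lambda)\subset N_\epsilon(f_{dm})\right\}=1,$$ where $\mathscr{D}_m(n)$ is the set of semi-strict unimodal sequences of size $n$ and $dm(n)=\#\mathscr{D}_m(n)$.
   Context: A unimodal sequence of size $n$ is a finite sequence $\lambda=(\lambda_1,\dots,\lambda_s)$ of positive integers with $\sum_{j=1}^s\lambda_j=n$ such that for some $k$, $0<\lambda_1\le\dots\le\lambda_{k-1}\le\lambda_k\ge\lambda_{k+1}\ge\dots\ge\lambda_s>0$. Its peaks are $\lambda_k$ and any other parts equal to $\lambda_k$ (i.e. the parts of maximal size). It is semi-strict if there is a single peak and the inequalities to the left of it are strict: $\lambda_1<\dots<\lambda_{k-1}<\lambda_k>\lambda_{k+1}\ge\dots\ge\lambda_s$. The diagram of $\lambda$ is the set of adjacent columns of unit squares in the plane standing on the $x$-axis, the $j$-th column having $\lambda_j$ squares, placed horizontally so that the left edge of the left-most peak column lies on the $y$-axis; that is, if $k$ is the smallest index with $\lambda_k$ maximal, the $j$-th column is $[j-k,j-k+1]\times[0,\lambda_j]$. The shape $\varphi(\lambda)$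 is the upper border of the diagram: the polygonal path, consisting of horizontal and vertical segments, that starts at the left-most bottom corner of the diagram on the $x$-axis, follows the tops of the columns (with the vertical segments joining consecutive tops), and ends at the right-most bottom corner on the $x$-axis. The renormalized shape $\widetilde{\varphi}(\lambda)$ is obtained from $\varphi(\lambda)$ by rescaling both axes by $1/\sqrt n$, where $n$ is the size of $\lambda$. For a real function $f$ defined on a subset of $\mathbb{R}$, $N_\epsilon(f)$ is the set of points in the plane whose horizontal distance from the curve $y=f(x)$ is at most $\epsilon$ (i.e. points $(x_0,y_0)$ for which there is $x$ in the domain of $f$ with $f(x)=y_0$ and $|x-x_0|\le\epsilon$), together with the $\epsilon$-neighborhoods of the $x$-axis and of the $y$-axis (points at distance at most $\epsilon$ from one of the axes). *)

(* Defs.v *)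
From mathcomp Require Import all_boot all_order all_algebra finmap.
From mathcomp Require Import all_classical all_reals all_analysis.

Set Implicit Arguments.
Unset Strict Implicit.
Unset Printing Implicit Defensive.

Import Order.TTheory GRing.Theory Num.Theory.
Import numFieldNormedType.Exports.

Local Open Scope classical_set_scope.
Local Open Scope ring_scope.

(* Parts are indexed from 0; the existential index k is a position of the peak. *)
Definition unimodal (s : seq nat) : bool :=
  all (leq 1) s &&
  [exists k : 'I_(size s), sorted leq (take k.+1 s) && sorted geq (drop k s)].

(* s_0 < ... < s_(k-1) < s_k > s_(k+1) >= ... >= s_(size s - 1).  When k is the
   last index, the middle inequality reads 0 < s_k, which [unimodal] gives. *)
Definition semistrict (s : seq nat) : bool :=
  [exists k : 'I_(size s),
    [&& sorted ltn (take k.+1 s),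
        (nth 0%N s k.+1 < nth 0%N s k)%N
      & sorted geq (drop k.+1 s)]].

Definition Dm (n : nat) : set (seq nat) :=
  [set s | unimodal s /\ semistrict s /\ sumn s = n].

(* [fset_set] sends infinite sets to the empty set; see [finite_Dm]. *)
Definition card_set (A : set (seq nat)) : nat := #|` fset_set A|%fset.

Definition dm (n : nat) : nat := card_set (Dm n).

Definition first_peak (s : seq nat) : nat := index (\max_(x <- s) x)%N s.

Section Shape.
Variable R : realType.

Definition segment (p q : R * R) : set (R * R) :=
  [set ((1 - t) * p.1 + t * q.1, (1 - t) * p.2 + t * q.2) | t in `[0, 1]].

Fixpoint polyline (p : R * R) (ps : seq (R * R)) : set (R * R) :=
  if ps is q :: ps' then segment p q `|` polyline q ps' else [set p].

(* [a] is the abscissa of the left edge of the first column of [s]; the path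
   visits the two top corners of each column and then the last bottom corner. *)
Fixpoint border_vertices (a : R) (s : seq nat) : seq (R * R) :=
  if s is h :: s' then
    [:: (a, h%:R), (a + 1, h%:R) & border_vertices (a + 1) s']
  else [:: (a, 0)].

Definition shape (s : seq nat) : set (R * R) :=
  let a := - (first_peak s)%:R in polyline (a, 0) (border_vertices a s).

Definition renormalized_shape (s : seq nat) : set (R * R) :=
  [set (p.1 / Num.sqrt (sumn s)%:R, p.2 / Num.sqrt (sumn s)%:R)
     | p in shape s].

(* The real function being thickened is [f] restricted to [D]. *)
Definition Nbhd (eps : R) (D : set R) (f : R -> R) : set (R * R) :=
  [set p | (exists x, [/\ D x, f x = p.2 & `|x - p.1| <= eps])
           \/ `|p.2| <= eps \/ `|p.1| <= eps].

Definition fdm_dom : set R :=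
  `[- (2 / pi) * ln 2, 0[ `|` `]0, +oo[.

Definition fdm (x : R) : R :=
  if x < 0 then - (2 / pi) * ln (expR (- (pi / 2) * x) - 1)
  else - (2 / pi) * ln (1 - expR (- (pi / 2) * x)).

End Shape.

Lemma finite_Dm (n : nat) : finite_set (Dm n).
Proof.
pose g (m : {m : 'I_n.+1 & m.-tuple 'I_n.+1}) : seq nat :=
  [seq nat_of_ord i | i <- tagged m].
apply: (@sub_finite_set _ _ (g @` setT)); last first.
  exact/finite_image/finite_finset.
move=> s [/andP[s1 _] [_ sn]].
have szs : (size s < n.+1)%N.
  rewrite ltnS -sn; elim: s s1 {sn} => //= x s IH /andP[x1 /IH].
  by move=> h; rewrite -add1n leq_add.
have les x : x \in s -> (x < n.+1)%N.
  rewrite ltnS -sn; elim: s {s1 sn szs} => //= y s IH.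
  rewrite inE => /orP[/eqP->|/IH h]; first exact: leq_addr.
  exact: leq_trans h (leq_addl _ _).
pose t : seq 'I_n.+1 := [seq inord x | x <- s].
have szt : size t == Ordinal szs by rewrite size_map.
exists (existT (fun m : 'I_n.+1 => m.-tuple 'I_n.+1) (Ordinal szs) (Tuple szt)) => //.
rewrite /g /= /t -map_comp -[RHS]map_id; apply/eq_in_map => x xs /=.
by rewrite inordK// les.
Qed.

(* Main.v *)
Require Import Defs.
From mathcomp Require Import all_boot all_order all_algebra finmap.
From mathcomp Require Import all_classical all_reals all_analysis.
From mathcomp Require Import zify ring lra.
Import Order.TTheory GRing.Theory Num.Theory.
Import numFieldNormedType.Exports.
Set Implicit Arguments.
Unset Strict Implicit.
Unset Printing Implicit Defensive.

Local Open Scope classical_set_scope.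
Local Open Scope ring_scope.

(** Let s be a semi-strict unimodal sequence of size n.  Its peak is n minus the sum
    of the other parts, so s is determined by a configuration: the sizes occurring
    on the left of the peak, each at most once, and the multiplicities of the sizes
    occurring on the right.  Conversely a configuration of total size less than
    n - M, with parts at most M, becomes a semi-strict sequence when the missing mass
    is given to the peak ([encode_inj], [dm_ge]).

    Weigh a configuration by exp(- t * size) and put q = exp(- t).  The
    multiplicities become independent and the total weight is the product of
    (1 + q ^ j) / (1 - q ^ j), whose logarithm is about pi ^ 2 / (4 t) for small t,
    because the inverse squares of the odd integers add up to pi ^ 2 / 8
    ([sum_inv_odd2_bounds], [log_gen_le], [log_gen_ge]).

    Exponential bounds then compare two counts.  First, tilting t both ways shows
    that most of the weight sits at sizes close to pi ^ 2 / (4 t ^ 2), whence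
    dm n >= exp((pi - d) sqrt n) for every d > 0 and n large ([dm_lower]).  Second,
    tilting the number of parts greater than k on one side shows that the
    configurations in which this number differs by more than a fixed multiple of
    sqrt n from its expected value number at most exp((pi - 2 d) sqrt n), for some
    d > 0 and uniformly in the k that are not o(sqrt n) ([config_tail_deviation],
    [card_outside_le]).  So with proportion tending to 1 all these numbers are close
    to their expected values.

    It remains to read off the shape.  At height y the border is as far from the
    vertical axis as there are parts larger than y on that side
    ([shape_between_tails]), and the expected numbers, rescaled, are
    (2 / pi) log (1 + exp(- pi y / 2)) on the left and
    - (2 / pi) log (1 - exp(- pi y / 2)) on the right: these are the inverses of the
    two branches of the limit curve ([fdm_tail_profile]). *)

(** * The sum of the inverse squares of the odd integers *)

Section Basel.
Variable R : realType.
Implicit Types (x y : R) (n k : nat).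

(** The mean value theorem in the form used below: the derivative is known on
    the closed interval, so continuity comes for free. *)
Lemma MVT_origin (f df : R -> R) x : 0 < x ->
  (forall y, 0 <= y <= x -> is_derive y 1 f (df y)) ->
  exists2 c, 0 < c < x & f x - f 0 = df c * x.
Proof.
move=> x0 dfP.
have [|||c cx ->] := @MVT R f df 0 x; first exact: x0.
- by move=> y; rewrite in_itv/= => /andP[/ltW ? /ltW ?]; apply: dfP; apply/andP.
- apply: continuous_in_subspaceT => y; rewrite inE/= in_itv/= => yx.
  apply/differentiable_continuous/derivable1_diffP.
  exact: (@ex_derive _ _ _ _ _ _ _ (dfP y yx)).
- by exists c; [rewrite in_itv/= in cx | rewrite subr0].
Qed.

Lemma sin_le x : 0 <= x -> sin x <= x.
Proof.
rewrite le_eqVlt => /predU1P[<-|x0]; first by rewrite sin0.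
have [c _] := @MVT_origin (@sin R) (@cos R) x x0 (fun y _ => is_derive_sin y).
rewrite sin0 subr0 => ->.
by rewrite ler_piMl ?cos_le1// ltW.
Qed.

Lemma le_tan x : 0 <= x < pi / 2 -> x <= tan x.
Proof.
move=> /andP[]; rewrite le_eqVlt => /predU1P[<-|x0 xpi]; first by rewrite tan0.
have cosP y : 0 <= y <= x -> 0 < cos y.
  move=> /andP[y0 yx]; apply: cos_gt0_pihalf; rewrite (le_lt_trans yx xpi) andbT.
  by rewrite (lt_le_trans _ y0)// oppr_lt0 divr_gt0// pi_gt0.
have [y /cosP yc|c cx] := @MVT_origin (@tan R) (fun y => (cos y) ^- 2) x x0.
  exact/is_derive_tan/lt0r_neq0.
rewrite tan0 subr0 => ->; rewrite ler_peMl ?(ltW x0)//.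
have c0 : 0 < cos c by apply: cosP; case/andP: cx => /ltW-> /ltW->.
by rewrite invf_ge1 ?exprn_gt0// exprn_ile1// ?cos_le1 ?ltW.
Qed.

(** This is sin x <= x <= tan x, rewritten with 1 / tan^2 = 1 / sin^2 - 1: the
    inverse squares that must be summed differ by at most 1 from terms whose sum
    over [odd_angle] is known exactly. *)
Lemma sin_inv2_bounds x : 0 < x < pi / 2 ->
  (sin x) ^- 2 - 1 <= x ^- 2 <= (sin x) ^- 2.
Proof.
move=> /andP[x0 xpi].
have s0 : 0 < sin x by apply: sin_gt0_pihalf; rewrite x0.
have c0 : 0 < cos x.
  by apply: cos_gt0_pihalf; rewrite xpi (lt_trans _ x0)// oppr_lt0 divr_gt0 ?pi_gt0.
apply/andP; split; last first.
  rewrite lef_pV2 ?posrE ?exprn_gt0//.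
  by rewrite ler_pXn2r ?nnegrE ?(ltW s0) ?(ltW x0)// sin_le// ltW.
have -> : (sin x) ^- 2 - 1 = (tan x) ^- 2.
  by rewrite /tan expr_div_n invf_div cos2sin2; field; rewrite lt0r_neq0.
have t0 : 0 < tan x by rewrite divr_gt0.
rewrite lef_pV2 ?posrE ?exprn_gt0//.
by rewrite ler_pXn2r ?nnegrE ?(ltW t0) ?(ltW x0)// le_tan// (ltW x0).
Qed.

Definition odd_angle n k : R := k.*2.+1%:R * pi / (2 ^ n.+2)%:R.

Lemma odd_angle_bounds n k : (k < 2 ^ n)%N -> 0 < odd_angle n k < pi / 2.
Proof.
move=> kn; rewrite /odd_angle !(divr_gt0, mulr_gt0) ?pi_gt0 ?ltr0n ?expn_gt0//=.
rewrite ltr_pdivrMr ?ltr0n ?expn_gt0// expnS natrM mulrA divfK//.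
rewrite mulrC ltr_pM2l ?pi_gt0// ltr_nat expnS; lia.
Qed.

(** From 1 / sin^2 x + 1 / cos^2 x = 4 / sin^2 (2 x).  The angles of level n + 1
    come in pairs x, pi / 2 - x, and doubling the smaller one of each pair gives
    the angles of level n, so the sum is multiplied by 4 at each level. *)
Lemma sum_inv_sin2 n :
  \sum_(k < 2 ^ n) (sin (odd_angle n k)) ^- 2 = 2 * 4 ^+ n :> R.
Proof.
elim: n => [|n IH].
  rewrite expn0 big_ord1 /odd_angle.
  have -> : (0%N.*2.+1)%:R * pi / (2 ^ 2)%:R = pi / 4 :> R by rewrite mul1r.
  have c0 : cos (pi / 4) != 0 :> R.
    apply: lt0r_neq0; apply: cos_gt0_pihalf; have := pi_gt0 R; lra.
  have := cos2_tan2 c0; rewrite tan_piquarter expr1n.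
  have := cos2sin2 (pi / 4 : R) => -> h.
  have e : 1 - sin (pi / 4) ^+ 2 = 2^-1 :> R by apply: invr_inj; rewrite h; field.
  have -> : sin (pi / 4) ^+ 2 = 2^-1 :> R by lra.
  by rewrite invrK mulr1.
(* Cut the range in half and reverse the upper half, which pairs k with
   2 ^ n.+1 - 1 - k. *)
rewrite -(big_mkord xpredT (fun k => sin (odd_angle n.+1 k) ^- 2)).
rewrite (@big_cat_nat _ _ _ (2 ^ n)%N)//=; last by rewrite leq_exp2l.
rewrite [X in _ + X]big_nat_rev/= [X in _ + X](big_addn 0 _ (2 ^ n)%N).
have -> : (2 ^ n.+1 - 2 ^ n = 2 ^ n)%N by rewrite expnS; lia.
rewrite -big_split/= big_mkord.
rewrite exprS mulrCA -IH big_distrr/=; apply: eq_bigr => k _.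
have kn := ltn_ord k.
have -> : odd_angle n.+1 (2 ^ n + 2 ^ n.+1 - (k + 2 ^ n).+1)
    = pi / 2 - odd_angle n.+1 k.
  rewrite /odd_angle.
  have -> : (2 ^ n + 2 ^ n.+1 - (k + 2 ^ n).+1).*2.+1 = (2 ^ n.+2 - k.*2.+1)%N.
    by rewrite !expnS; lia.
  rewrite natrB; last by rewrite !expnS; lia.
  rewrite mulrBl mulrBl; congr (_ - _).
  rewrite [(2 ^ n.+3)%N]expnS [X in _ / X]natrM; field.
  by rewrite pnatr_eq0 expn_eq0.
have -> : odd_angle n k = odd_angle n.+1 k *+ 2.
  rewrite /odd_angle [(2 ^ n.+3)%N]expnS [X in _ / X *+ _]natrM mulr2n; field.
  by rewrite pnatr_eq0 expn_eq0.
have /odd_angle_bounds/andP[a0 api] : (k < 2 ^ n.+1)%N.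
  by rewrite (leq_trans kn)// leq_exp2l.
have c0 : 0 < cos (odd_angle n.+1 k).
  by apply: cos_gt0_pihalf; rewrite api (lt_trans _ a0)// oppr_lt0 divr_gt0 ?pi_gt0.
have s0 : 0 < sin (odd_angle n.+1 k) by apply: sin_gt0_pihalf; rewrite a0.
rewrite -[in X in _ + X]opprB sinN sinBpihalf opprK sin_mulr2n.
have := cos2Dsin2 (odd_angle n.+1 k).
move: (sin _) (cos _) s0 c0 => s c s0 c0 sc.
have -> : s ^- 2 + c ^- 2 = (c ^+ 2 + s ^+ 2) / (s ^+ 2 * c ^+ 2).
  by field; rewrite !lt0r_neq0.
rewrite sc -mulr_natr; field; rewrite -?mulr2n ?mulrn_eq0 ?mulf_neq0 ?lt0r_neq0//.
Qed.

(** The squeeze costs at most 1 for each of the 2 ^ n terms, against a total of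
    2 * 4 ^ n: this is the relative error 2 ^- n. *)
Lemma sum_inv_odd2_bounds n :
  (pi : R) ^+ 2 / 8 * (1 - 2^-1 ^+ n) <=
  \sum_(k < 2 ^ n) (k.*2.+1)%:R ^- 2 <= (pi : R) ^+ 2 / 8.
Proof.
have pi0 := pi_gt0 R.
have E : \sum_(k < 2 ^ n) (k.*2.+1)%:R ^- 2 =
    pi ^+ 2 / (16 * 4 ^+ n) * \sum_(k < 2 ^ n) (odd_angle n k) ^- 2 :> R.
  rewrite big_distrr/=; apply: eq_bigr => k _.
  rewrite /odd_angle natrX !exprS -[4]/((2 * 2)%N%:R : R) natrM exprMn.
  have : (k.*2.+1)%:R != 0 :> R by rewrite pnatr_eq0.
  have : 2 ^+ n != 0 :> R by rewrite expf_neq0 ?pnatr_eq0.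
  have : pi != 0 :> R by rewrite lt0r_neq0.
  move: (k.*2.+1%:R) (2 ^+ n) (pi) => a b c c0 b0 a0.
  by field; rewrite a0 b0 c0.
have n4 : 0 < 4 ^+ n :> R by rewrite exprn_gt0.
rewrite E; apply/andP; split; last first.
  apply: (@le_trans _ _ (pi ^+ 2 / (16 * 4 ^+ n) * (2 * 4 ^+ n))).
    rewrite ler_pM2l ?divr_gt0 ?exprn_gt0 ?mulr_gt0//.
    rewrite -sum_inv_sin2; apply: ler_sum => k _.
    by case/andP: (sin_inv2_bounds (odd_angle_bounds (ltn_ord k))).
  suff -> : pi ^+ 2 / (16 * 4 ^+ n) * (2 * 4 ^+ n) = pi ^+ 2 / 8 :> R by [].
  by field; rewrite lt0r_neq0.
apply: (@le_trans _ _ (pi ^+ 2 / (16 * 4 ^+ n) * (2 * 4 ^+ n - 2 ^+ n))); last first.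
  rewrite ler_pM2l ?divr_gt0 ?exprn_gt0 ?mulr_gt0//.
  rewrite -sum_inv_sin2.
  have -> : 2 ^+ n = \sum_(k < 2 ^ n) 1 :> R.
    by rewrite sumr_const card_ord natrX.
  rewrite -sumrB; apply: ler_sum => k _.
  by case/andP: (sin_inv2_bounds (odd_angle_bounds (ltn_ord k))).
rewrite -[4]/((2 * 2)%N%:R : R) natrM exprMn exprVn.
set u := 2 ^+ n.
have u0 : 0 < u by rewrite exprn_gt0.
suff : pi ^+ 2 / (16 * (u * u)) * (2 * (u * u) - u) - pi ^+ 2 / 8 * (1 - u^-1)
   = pi ^+ 2 / (16 * u) :> R.
  have : 0 <= pi ^+ 2 / (16 * u) by rewrite ltW// divr_gt0 ?mulr_gt0.
  lra.
by field; rewrite lt0r_neq0.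
Qed.

Lemma sum_inv_odd2_le K : \sum_(k < K) (k.*2.+1)%:R ^- 2 <= (pi : R) ^+ 2 / 8.
Proof.
have [_ /andP[_]] := (tt, sum_inv_odd2_bounds K); apply: le_trans.
rewrite -!(big_mkord xpredT (fun k => k.*2.+1%:R ^- 2)).
rewrite [leRHS](@big_cat_nat _ _ _ K)//=; last exact/ltnW/ltn_expl.
by rewrite lerDl sumr_ge0// => i _; rewrite invr_ge0 exprn_ge0.
Qed.

Lemma sum_inv_odd2_ge (d : R) : 0 < d ->
  exists K, pi ^+ 2 / 8 - d <= \sum_(k < K) (k.*2.+1)%:R ^- 2.
Proof.
move=> d0.
have c0 : 0 < pi ^+ 2 / 8 :> R by rewrite divr_gt0 ?exprn_gt0 ?pi_gt0.
have [n hn] : exists n, 2^-1 ^+ n < d / (pi ^+ 2 / 8) :> R.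
  have /cvgrPdist_lt/(_ _ (divr_gt0 d0 c0)) : (GRing.exp (2^-1 : R)) @ \oo --> (0 : R).
    by apply: cvg_expr; rewrite ger0_norm ?invf_lt1 ?ltr1n.
  move=> [n _ /(_ n)/(_ (leqnn n))]; rewrite sub0r normrN ger0_norm ?exprn_ge0//.
  by exists n.
exists (2 ^ n)%N; case/andP: (sum_inv_odd2_bounds n) => + _; apply: le_trans.
by rewrite mulrBr mulr1 lerB// mulrC ltW// -ltr_pdivlMr.
Qed.

End Basel.

(** * Asymptotics of the logarithm of the generating product *)

Section LogSeries.
Variable R : realType.
Implicit Types (x y t a : R) (n k K M : nat).

(** Twice the inverse hyperbolic tangent: only odd powers occur in its series. *)
Definition odd_log x : R := ln (1 + x) - ln (1 - x).

Definition odd_log_series K x : R :=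
  2 * \sum_(k < K) x ^+ k.*2.+1 / k.*2.+1%:R.

Lemma is_derive_odd_log_series K y :
  is_derive y 1 (odd_log_series K) (2 * \sum_(k < K) y ^+ k.*2).
Proof.
rewrite /odd_log_series; elim: K => [|K IH].
  rewrite (_ : (fun _ => _) = cst 0); last by apply/funext => z; rewrite big_ord0 mulr0.
  by rewrite big_ord0 mulr0; exact: is_derive_cst.
rewrite (_ : (fun _ => _) = (fun z : R => 2 * (\sum_(k < K) z ^+ k.*2.+1 / k.*2.+1%:R))
    + (2 / K.*2.+1%:R : R) \*: ((fun z => z ^+ K.*2.+1) : R -> R)); last first.
  apply/funext => z; rewrite big_ord_recr/= mulrDr; congr (_ + _).
  by rewrite -[RHS]/(2 / K.*2.+1%:R * z ^+ K.*2.+1); ring.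
rewrite big_ord_recr/= mulrDr; apply: is_deriveD.
have h : is_derive y 1 (fun z : R => z ^+ K.*2.+1) (K.*2.+1%:R * y ^+ K.*2).
  apply: DeriveDef; first exact: exprn_derivable.
  by rewrite exp_derive [LHS]mulr1.
apply: is_derive_eq.
rewrite -[LHS]/(2 / K.*2.+1%:R * (K.*2.+1%:R * y ^+ K.*2)); by field; rewrite addrC natr1 pnatr_eq0.
Qed.

(** The derivative of the remainder is 2 y ^ (2 K) / (1 - y ^ 2), a geometric
    tail; the mean value theorem turns it into a bound on the remainder. *)
Lemma odd_log_series_bounds K x : 0 <= x < 1 ->
  0 <= odd_log x - odd_log_series K x <= 2 * x ^+ K.*2.+1 / (1 - x ^+ 2).
Proof.
move=> /andP[]; rewrite le_eqVlt => /predU1P[<- _|x0 x1].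
  rewrite /odd_log /odd_log_series addr0 subr0 subrr sub0r.
  rewrite big1 ?mulr0 ?oppr0 ?lexx/=; last by move=> k _; rewrite expr0n/= mul0r.
  by rewrite expr0n/= mulr0 mul0r.
pose df y := (1 + y)^-1 + (1 - y)^-1 - 2 * \sum_(k < K) y ^+ k.*2.
have dfE y : 0 <= y < 1 -> df y = 2 * y ^+ K.*2 / (1 - y ^+ 2).
  move=> /andP[y0 y1]; rewrite /df.
  have -> : \sum_(k < K) y ^+ k.*2 = (1 - y ^+ K.*2) / (1 - y ^+ 2).
    apply: canRL (mulfK _) _; first by rewrite subr_eq0 eq_sym lt_eqF// expr_lt1.
    rewrite -[K.*2]mul2n exprM -[RHS]opprB subrX1 -[RHS]mulNr opprB mulrC; congr (_ * _).
    by apply: eq_bigr => k _; rewrite -mul2n exprM.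
  have -> : 1 - y ^+ 2 = (1 + y) * (1 - y) by ring.
  by field; rewrite !lt0r_neq0//; lra.
have [y|c cx] := @MVT_origin R (fun y => odd_log y - odd_log_series K y) df x x0.
  move=> /andP[y0 yx]; rewrite /df /odd_log.
  have ? := is_derive_odd_log_series K y.
  have ? : is_derive (1 + y) 1 (@ln R) (1 + y)^-1 by apply: is_derive1_ln; lra.
  have ? : is_derive (1 - y) 1 (@ln R) (1 - y)^-1 by apply: is_derive1_ln; lra.
  apply: is_deriveB.
  apply: is_derive_eq.
  rewrite /GRing.scale/=; ring.
have -> : odd_log 0 - odd_log_series K 0 = 0.
  rewrite /odd_log /odd_log_series addr0 subr0 subrr sub0r.
  by rewrite big1 ?mulr0 ?oppr0// => k _; rewrite expr0n/= mul0r.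
have c0 : 0 < c by case/andP: cx.
have cx' : c < x by case/andP: cx.
rewrite subr0 dfE ?(ltW c0)/= ?(lt_trans cx')// => ->.
have h y : 0 < y <= x -> 0 < 1 - y ^+ 2.
  move=> /andP[y0 yx]; rewrite subr_gt0 expr_lt1 ?(ltW y0)//.
  exact: le_lt_trans x1.
have hc := h c; have hx := h x.
rewrite !mulr_ge0 ?exprn_ge0 ?invr_ge0 ?(ltW c0) ?(ltW x0)//=; last by rewrite ltW// hc ?c0 ?ltW.
rewrite [X in _ <= 2 * X / _]exprSr mulrA [leRHS]mulrAC ler_pM2r//.
apply: ler_pM.
- by rewrite mulr_ge0 ?exprn_ge0 ?ltW.
- by rewrite invr_ge0 ltW// hc ?c0 ?ltW.
- by rewrite ler_pM2l//; apply: lerXn2r; rewrite ?nnegrE ltW.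
have hc0 : 0 < 1 - c ^+ 2 by rewrite hc ?c0 ?ltW.
have hx0 : 0 < 1 - x ^+ 2 by rewrite hx ?x0 ?lexx.
rewrite lef_pV2 ?posrE//.
by rewrite lerD2l lerN2; apply: lerXn2r; rewrite ?nnegrE ltW.
Qed.

Lemma odd_log_series_le K x : 0 <= x < 1 -> odd_log_series K x <= odd_log x.
Proof. by move=> /(odd_log_series_bounds K)/andP[+ _]; rewrite subr_ge0. Qed.

Lemma odd_log_series_cvg x : 0 <= x < 1 ->
  (odd_log_series K x) @[K --> \oo] --> odd_log x.
Proof.
move=> x01; have /andP[x0 x1] := x01.
have h : (2 / (1 - x ^+ 2) * x * (x ^+ 2) ^+ K) @[K --> \oo] --> (2 / (1 - x ^+ 2) * x * 0 : R).
  apply: cvgM; first exact: cvg_cst.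
  by apply: cvg_expr; rewrite ger0_norm ?exprn_ge0// expr_lt1.
rewrite mulr0 in h.
have h' : (odd_log x - 2 / (1 - x ^+ 2) * x * (x ^+ 2) ^+ K) @[K --> \oo] --> (odd_log x - 0).
  by apply: cvgB => //; exact: cvg_cst.
rewrite subr0 in h'.
apply: (@squeeze_cvgr _ _ _ _ (fun K => odd_log x - 2 / (1 - x ^+ 2) * x * (x ^+ 2) ^+ K) (cst (odd_log x))); last exact: cvg_cst; last by [].
apply: nearW => K /=; rewrite odd_log_series_le// andbT lerBlDr -lerBlDl.
case/andP: (odd_log_series_bounds K x01) => _ /le_trans; apply.
suff -> : 2 * x ^+ K.*2.+1 / (1 - x ^+ 2) = 2 / (1 - x ^+ 2) * x * (x ^+ 2) ^+ K by [].
by rewrite -exprM exprS mul2n; ring.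
Qed.

(** The infinite sum is 1 / (exp(r t) - 1), which lies between 1 / (r t) - 1 and
    1 / (r t); cutting it at M multiplies it by 1 - exp(- r t M), which is at least
    1 - exp(- t M). *)
Lemma geometric_sum_bounds t r M : 0 < t -> 1 <= r ->
  (1 - expR (- t * M%:R)) / (r * t) - 1 <=
  \sum_(j < M) expR (- (r * t)) ^+ j.+1 <= (r * t)^-1.
Proof.
move=> t0 r1; have r0 : 0 < r := lt_le_trans ltr01 r1.
set a := expR (- (r * t)).
have rt0 : 0 < r * t by rewrite mulr_gt0.
have a0 : 0 < a by exact: expR_gt0.
have a1 : a < 1 by rewrite expR_lt1 oppr_lt0.
have ad : 1 - a <= r * t by have := expR_ge1Dx (- (r * t)); rewrite -/a; lra.
have -> : \sum_(j < M) a ^+ j.+1 = a / (1 - a) * (1 - a ^+ M).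
  rewrite (eq_bigr (fun j : 'I_M => a * a ^+ j)); last by move=> j _; rewrite exprS.
  rewrite -big_distrr/= -mulrA; congr (_ * _).
  apply: canRL (mulKf _) _; first by rewrite subr_eq0 eq_sym lt_eqF.
  by rewrite -opprB mulNr -subrX1 opprB.
have aM0 : 0 <= a ^+ M by rewrite exprn_ge0// ltW.
have aMq : a ^+ M <= expR (- t * M%:R).
  rewrite -expRM_natr ler_expR mulrC [leRHS]mulrC ler_wpM2l// lerN2.
  by rewrite ler_peMl// ltW.
have q1 : expR (- t * M%:R) <= 1 by rewrite expR_le1 mulNr oppr_le0 mulr_ge0// ltW.
have q0 := expR_gt0 (- t * M%:R).
have b0 : 0 < a / (1 - a) by rewrite divr_gt0// subr_gt0.
apply/andP; split.
- have b1 : (r * t)^-1 - 1 <= a / (1 - a).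
    have -> : a / (1 - a) = (1 - a)^-1 - 1 by field; rewrite subr_eq0 gt_eqF.
    by rewrite lerB// lef_pV2 ?posrE// subr_gt0.
  have : 0 < (r * t)^-1 by rewrite invr_gt0.
  move: (_^-1) (a / _) (a ^+ M) (expR _) b0 b1 aM0 aMq q1 q0 => X b c q *; nra.
- apply: (@le_trans _ _ (a / (1 - a))).
    by rewrite ler_piMr ?(ltW b0)// gerBl.
  have -> : a / (1 - a) = (a^-1 - 1)^-1.
    by field; apply/andP; split; apply: lt0r_neq0 => //; lra.
  rewrite /a -expRN opprK lef_pV2 ?posrE//; first by have := expR_ge1Dx (r * t); lra.
  by rewrite subr_gt0 expR_gt1.
Qed.

(** The logarithm of the product of (1 + q ^ j) / (1 - q ^ j) over
    1 <= j <= M, where q = exp(- t). *)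
Definition log_gen M t : R := \sum_(j < M) odd_log (expR (- t) ^+ j.+1).

Lemma expRN_pow01 t j : 0 < t -> 0 <= expR (- t) ^+ j.+1 < 1.
Proof.
move=> t0; rewrite exprn_ge0 ?expR_ge0//= expr_lt1// ?expR_ge0//.
by rewrite expR_lt1 oppr_lt0.
Qed.

Lemma sum_odd_log_series M K t :
  \sum_(j < M) odd_log_series K (expR (- t) ^+ j.+1) =
  2 * \sum_(k < K) (k.*2.+1%:R)^-1 *
       \sum_(j < M) expR (- (k.*2.+1%:R * t)) ^+ j.+1.
Proof.
rewrite -big_distrr/= exchange_big/=; congr (_ * _); apply: eq_bigr => k _.
rewrite big_distrr/=; apply: eq_bigr => j _.
by rewrite mulrC -mulrN expRM_natl exprAC.
Qed.

(** Expanding each factor into its series and exchanging the sums leaves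
    2 / (2 k + 1) times a geometric sum at most 1 / ((2 k + 1) t); the constant
    pi ^ 2 / 4 is then twice the sum of the inverse odd squares. *)
Lemma log_gen_le M t : 0 < t -> log_gen M t <= pi ^+ 2 / 4 / t.
Proof.
move=> t0.
have cv : (\sum_(j < M) odd_log_series K (expR (- t) ^+ j.+1)) @[K --> \oo] --> log_gen M t.
  apply: cvg_big => [|j _]; first exact: add_continuous.
  apply: odd_log_series_cvg; exact: expRN_pow01.
apply: (cvgr_to_le cv); apply: nearW => K; rewrite sum_odd_log_series.
apply: (@le_trans _ _ (2 * (\sum_(k < K) (k.*2.+1)%:R ^- 2 / t))).
  rewrite ler_pM2l//; apply: ler_sum => k _.
  have k0 : 0 < k.*2.+1%:R :> R by rewrite ltr0n.
  have k1 : 1 <= k.*2.+1%:R :> R by rewrite ler1n.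
  have /andP[_ h] := geometric_sum_bounds M t0 k1.
  rewrite (_ : _ / t = k.*2.+1%:R^-1 * (k.*2.+1%:R * t)^-1).
    by rewrite ler_pM2l ?invr_gt0.
  by rewrite -exprVn expr2 -mulrA -invfM.
rewrite -big_distrl/= mulrA ler_pM2r ?invr_gt0//.
have := sum_inv_odd2_le R K; lra.
Qed.

(** The matching lower bound, with the series cut at K: as t tends to 0 and t M
    to infinity, the first term dominates. *)
Lemma log_gen_ge M K t : 0 < t ->
  2 * (\sum_(k < K) (k.*2.+1)%:R ^- 2) * (1 - expR (- t * M%:R)) / t - 2 * K%:R
  <= log_gen M t.
Proof.
move=> t0.
apply: (@le_trans _ _ (\sum_(j < M) odd_log_series K (expR (- t) ^+ j.+1))); last first.
  by apply: ler_sum => j _; apply: odd_log_series_le; exact: expRN_pow01.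
rewrite sum_odd_log_series -!mulrA -mulrBr ler_pM2l//.
have -> : K%:R = \sum_(k < K) 1 :> R by rewrite sumr_const card_ord.
rewrite big_distrl/= -sumrB; apply: ler_sum => k _.
have k0 : 0 < k.*2.+1%:R :> R by rewrite ltr0n.
have k1 : 1 <= k.*2.+1%:R :> R by rewrite ler1n.
have /andP[h _] := geometric_sum_bounds M t0 k1.
apply: (@le_trans _ _ (k.*2.+1%:R^-1 * ((1 - expR (- t * M%:R)) / (k.*2.+1%:R * t) - 1))); last first.
  by rewrite ler_pM2l ?invr_gt0.
have : k.*2.+1%:R^-1 <= 1 :> R by rewrite invf_le1// ler1n.
rewrite expr2 !invfM; move: k.*2.+1%:R^-1 (1 - _) t^-1 => y z w; lra.
Qed.

End LogSeries.

(** * The limit profiles *)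

Section Profile.
Variable R : realType.
Implicit Types (left : bool) (u v t w : R).

(** For small t, [tail_profile left (t * h) / t] approximates the expected number
    of parts of size at least h on one side, for multiplicities weighted by exp(- t * size): at most
    one copy of each size on the left, any number on the right. *)
Definition tail_profile left u : R :=
  if left then ln (1 + expR (- u)) else - ln (1 - expR (- u)).

(** The mean multiplicity of a part (Fermi-Dirac on the left, Bose-Einstein on
    the right), and also minus the derivative of [tail_profile]. *)
Definition tail_density left u : R :=
  (expR u + (if left then 1 else -1))^-1.

Lemma tail_density_den_ge left u : u <= expR u + (if left then 1 else -1).
Proof. by have := expR_ge1Dx u; case: left; lra. Qed.

Lemma tail_density_gt0 left u : 0 < u -> 0 < tail_density left u.
Proof.
by move=> u0; rewrite invr_gt0 (lt_le_trans u0)// tail_density_den_ge.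
Qed.

Lemma tail_density_le left u : 0 < u -> tail_density left u <= u^-1.
Proof.
move=> u0; rewrite lef_pV2 ?posrE ?tail_density_den_ge//.
by rewrite (lt_le_trans u0)// tail_density_den_ge.
Qed.

Lemma tail_profile_ge0 left u : 0 < u -> 0 <= tail_profile left u.
Proof.
move=> u0; rewrite /tail_profile; case: left.
  by rewrite ln_ge0// lerDl expR_ge0.
by rewrite oppr_ge0 ln_le0// gerBl expR_ge0.
Qed.

(** Convexity of [tail_profile], as a tangent inequality.  It gives at once the
    comparison of sums of [tail_density] with differences of [tail_profile], so
    that no integral is needed. *)
Lemma tail_profile_tangent left u v : 0 < u -> 0 < v ->
  tail_profile left u - (v - u) * tail_density left u <= tail_profile left v.
Proof.
move=> u0 v0; set z := tail_density left u; set d := v - u.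
have x0 := expR_gt0 (- u).
have y0 := expR_gt0 (- v).
have x1 : expR (- u) < 1 by rewrite expR_lt1 oppr_lt0.
have y1 : expR (- v) < 1 by rewrite expR_lt1 oppr_lt0.
have yE : expR (- v) = expR (- u) * expR (- d).
  by rewrite -expRD; congr expR; rewrite /d; ring.
rewrite lerBlDr -lerBlDl /tail_profile.
have zE : z = expR (- u) / (1 + (if left then 1 else -1) * expR (- u)).
  rewrite /z /tail_density -[in LHS](opprK u) [expR (- - u)]expRN; case: left {z}.
    by field; rewrite !lt0r_neq0//; lra.
  by field; rewrite !lt0r_neq0//; lra.
case: left @z zE => z zE.
- have z01 : 0 < z < 1.
    by rewrite zE mul1r divr_gt0 ?ltr_pdivrMr ?mul1r/=; lra.
  rewrite -ln_div ?posrE ?addr_gt0//.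
  have -> : (1 + expR (- u)) / (1 + expR (- v)) = (1 - z + z * expR (- d))^-1.
    by rewrite zE yE; field; rewrite -yE; apply/andP; split; apply: lt0r_neq0; lra.
  (* Convexity of exp between 0 and - d, with weight z; it follows from two
     tangent inequalities after division by exp(- d z). *)
  have p : expR (- (d * z)) <= 1 - z + z * expR (- d).
    have h1 := expR_ge1Dx (d * z).
    have h2 := expR_ge1Dx (- d * (1 - z)).
    have -> : expR (- d) = expR (- (d * z)) * expR (- d * (1 - z)).
      by rewrite -expRD; congr expR; ring.
    have e1 : expR (d * z) * expR (- (d * z)) = 1 by rewrite expRxMexpNx_1.
    have e0 := expR_gt0 (- (d * z)).
    move: (expR _) (expR (- (d * z))) (expR (_ * (1 - z))) h1 h2 e1 e0 => A B C h1 h2 e1 e0.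
    suff : 1 <= (1 - z) * A + z * C.
      move=> h; have := ler_wpM2l (ltW e0) h; rewrite mulr1 => /le_trans; apply.
      have -> : B * ((1 - z) * A + z * C) = (1 - z) * (A * B) + z * (B * C) by ring.
      by rewrite e1 mulr1.
    case/andP: z01 => z0 z1.
    nra.
  have q0 := lt_le_trans (expR_gt0 _) p.
  by rewrite -ler_expR lnK ?posrE ?invr_gt0// -[leRHS]invrK -expRN lef_pV2 ?posrE ?expR_gt0.
- have z0 : 0 < z by rewrite zE divr_gt0//; lra.
  rewrite opprK addrC -ln_div ?posrE ?subr_gt0//.
  have -> : (1 - expR (- v)) / (1 - expR (- u)) = 1 + z * (1 - expR (- d)).
    by rewrite zE yE; field; rewrite !lt0r_neq0//; lra.
  apply: (@le_trans _ _ (z * (1 - expR (- d)))).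
    apply: le_ln1Dx; rewrite -subr_gt0 opprK addrC.
    have -> : 1 + z * (1 - expR (- d)) = (1 - expR (- v)) / (1 - expR (- u)).
      by rewrite zE yE; field; rewrite !lt0r_neq0//; lra.
    by rewrite divr_gt0// subr_gt0.
  by rewrite mulrC ler_wpM2r ?(ltW z0)//; have := expR_ge1Dx (- d); lra.
Qed.

Lemma tail_profile_step left u t : 0 < u -> 0 < t ->
  t * tail_density left (u + t) <= tail_profile left u - tail_profile left (u + t)
    <= t * tail_density left u.
Proof.
move=> u0 t0; have ut0 : 0 < u + t by rewrite addr_gt0.
have := tail_profile_tangent left u0 ut0.
have := tail_profile_tangent left ut0 u0.
rewrite opprD addrA subrr sub0r addrAC subrr add0r mulNr opprK => h1 h2.
by apply/andP; split; lra.
Qed.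

Lemma tail_profile_le left u : 0 < u -> tail_profile left u <= u^-1.
Proof.
move=> u0; have x0 := expR_gt0 (- u).
have x1 : expR (- u) < 1 by rewrite expR_lt1 oppr_lt0.
have e0 := expR_gt0 u.
case: left; rewrite /tail_profile.
  apply: (@le_trans _ _ (expR (- u))); first by apply: le_ln1Dx; lra.
  rewrite expRN lef_pV2 ?posrE//; have := expR_ge1Dx u; lra.
rewrite -lnV ?posrE ?subr_gt0//.
have -> : (1 - expR (- u))^-1 = 1 + tail_density false u.
  have e1 : 1 < expR u by rewrite expR_gt1.
  by rewrite /tail_density expRN; field; rewrite !lt0r_neq0//; lra.
apply: le_trans (tail_density_le false u0).
by apply: le_ln1Dx; have := tail_density_gt0 false u0; lra.
Qed.

(** A telescoping sum of [tail_profile_step]. *)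
Lemma sum_tail_density_bounds left t k M : 0 < t -> (0 < k <= M)%N ->
  (tail_profile left (t * k.+1%:R) - tail_profile left (t * M.+1%:R)) / t
  <= \sum_(k <= i < M) tail_density left (t * i.+1%:R)
  <= (tail_profile left (t * k%:R) - tail_profile left (t * M%:R)) / t.
Proof.
move=> t0 /andP[k0 kM].
have step i : t * i.+1%:R = t * i%:R + t by rewrite -natr1 mulrDr mulr1.
have tele (f : nat -> R) : f k - f M = \sum_(k <= i < M) (f i - f i.+1).
  rewrite (eq_bigr (fun i => - (f i.+1 - f i))); last by move=> i _; rewrite opprB.
  by rewrite sumrN telescope_sumr// opprB.
rewrite ler_pdivrMr// ler_pdivlMr// (tele (fun i => tail_profile left (t * i.+1%:R))).
rewrite (tele (fun i => tail_profile left (t * i%:R))) big_distrl/=.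
apply/andP; split; apply: ler_sum_nat => i /andP[ki _].
  rewrite (step i.+1) [leRHS]mulrC.
  by case/andP: (@tail_profile_step left (t * i.+1%:R) t (mulr_gt0 t0 (ltr0Sn _ _)) t0).
rewrite step [leLHS]mulrC.
have : 0 < t * i%:R by rewrite mulr_gt0// ltr0n (leq_trans k0).
by move=> /(tail_profile_step left)/(_ t0)/andP[].
Qed.

End Profile.

(** * Configurations under the Boltzmann weight *)

(** For each size i + 1 <= M, whether it occurs on the left, and its number of
    occurrences, at most K, on the right.  The bound K makes the type finite; any
    K >= n is harmless for sequences of size n. *)
Definition config (M K : nat) := {ffun 'I_M -> bool * 'I_K.+1}.

Section ConfigStat.
Variables M K : nat.
Implicit Types (w : config M K) (k : nat).

Definition config_size w : nat := (\sum_(i < M) i.+1 * ((w i).1 + (w i).2))%N.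

Definition side_mult (left : bool) (p : bool * 'I_K.+1) : nat :=
  if left then nat_of_bool p.1 else nat_of_ord p.2.

(** The index k stands for the size k + 1, hence this counts the parts of size
    greater than k on one side. *)
Definition config_tail left k w : nat :=
  (\sum_(i < M | k <= i) side_mult left (w i))%N.
End ConfigStat.

Section Boltzmann.
Variable R : realType.
Variables M K : nat.
Implicit Types (t th a r : R) (left : bool) (k : nat).

Lemma sum_pair_side (x y : R) left :
  \sum_(p : bool * 'I_K.+1) x ^+ (p.1 + p.2) * y ^+ side_mult left p =
  (1 + (if left then y else 1) * x) *
  \sum_(c < K.+1) ((if left then 1 else y) * x) ^+ c.
Proof.
rewrite -(pair_big xpredT xpredT (fun (b : bool) (c : 'I_K.+1) =>
  x ^+ (b + c) * y ^+ side_mult left (b, c)))/= big_bool/= mulrDl mul1r addrC.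
rewrite big_distrr/=; congr (_ + _); apply: eq_bigr => c _; case: left => /=.
- by rewrite expr0 mulr1 mul1r.
- by rewrite exprMn mulrC.
- by rewrite expr1 mul1r exprS; ring.
- by rewrite mul1r exprMn exprS; ring.
Qed.

(** Sizes are independent under the weight exp(- t * size), so the exponential
    moment of a tail count is a product over the sizes. *)
Lemma config_moment t th left k :
  \sum_(w : config M K)
     expR (- t * (config_size w)%:R + th * (config_tail left k w)%:R) =
  \prod_(i < M) \sum_(p : bool * 'I_K.+1)
     expR (- (t * i.+1%:R)) ^+ (p.1 + p.2) *
     expR (if (k <= i)%N then th else 0) ^+ side_mult left p.
Proof.
rewrite bigA_distr_bigA/=; apply: eq_bigr => w _.
rewrite expRD !expRM_natr big_split/=; congr (_ * _).
  rewrite /config_size expr_sum; apply: eq_bigr => i _.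
  by rewrite exprM -expRM_natr mulNr.
rewrite /config_tail expr_sum big_mkcond/=; apply: eq_bigr => i _.
by case: ifP => //; rewrite expR0 expr1n.
Qed.

Lemma geometric_le (x : R) n : 0 <= x < 1 -> \sum_(c < n) x ^+ c <= (1 - x)^-1.
Proof.
move=> /andP[x0 x1]; rewrite -div1r ler_pdivlMr ?subr_gt0// mulrC -opprB mulNr -subrX1.
by rewrite opprB gerBl exprn_ge0.
Qed.

(** Without the bound K on multiplicities, tilting by th would multiply the factor
    (1 + x) / (1 - x) of one size, x = exp(- u), by exactly 1 + w on the left and 1 / (1 - w) on the right, where
    w = (exp th - 1) * density; both are at most exp(w + 2 w ^ 2). *)
Lemma site_moment_le (u th : R) left :
  0 < u -> `|(expR th - 1) * tail_density left u| <= 2^-1 ->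
  \sum_(p : bool * 'I_K.+1) expR (- u) ^+ (p.1 + p.2) * expR th ^+ side_mult left p
  <= expR (odd_log (expR (- u)) + (expR th - 1) * tail_density left u
           + 2 * ((expR th - 1) * tail_density left u) ^+ 2).
Proof.
move=> u0; set w := (_ - 1) * _ => wle.
have x0 := expR_gt0 (- u).
have x1 : expR (- u) < 1 by rewrite expR_lt1 oppr_lt0.
have y0 := expR_gt0 th.
have olE : expR (odd_log (expR (- u))) = (1 + expR (- u)) / (1 - expR (- u)).
  by rewrite /odd_log expRB !lnK ?posrE ?subr_gt0 ?addr_gt0.
rewrite sum_pair_side -addrA expRD olE.
have uE : expR u = (expR (- u))^-1 by rewrite -expRN opprK.
case: left @w wle => w wle /=.
- have -> : 1 + expR th * expR (- u) = (1 + expR (- u)) * (1 + w).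
    by rewrite /w /tail_density uE; field; rewrite !lt0r_neq0//; lra.
  have w0 : 0 < 1 + w by move: wle; rewrite ler_norml; lra.
  rewrite -[leRHS]mulrA [X in _ <= _ * X]mulrC -[leLHS]mulrA.
  apply: ler_wpM2l; first by rewrite addr_ge0 ?ltW.
  apply: ler_pM; [exact: ltW|by rewrite sumr_ge0// => c _; rewrite exprn_ge0// ltW| |].
    by apply: (le_trans (expR_ge1Dx w)); rewrite ler_expR lerDl mulr_ge0 ?sqr_ge0.
  under eq_bigr do rewrite mul1r.
  by apply: geometric_le; rewrite ltW.
- rewrite mul1r -mulrA; apply: ler_wpM2l; first by rewrite addr_ge0 ?ltW.
  have E : 1 - expR th * expR (- u) = (1 - expR (- u)) * (1 - w).
    by rewrite /w /tail_density uE; field; rewrite !lt0r_neq0//; lra.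
  have w0 : 0 < 1 - w by move: wle; rewrite ler_norml; lra.
  have E0 : 0 < 1 - expR th * expR (- u) by rewrite E mulr_gt0// subr_gt0.
  apply: (@le_trans _ _ (1 - expR th * expR (- u))^-1).
    by apply: geometric_le; rewrite mulr_ge0 ?ltW//; lra.
  rewrite E invfM ler_pM2l ?invr_gt0 ?subr_gt0//.
  apply: (@le_trans _ _ (1 + (w + 2 * w ^+ 2))); last exact: expR_ge1Dx.
  rewrite -div1r ler_pdivrMr//.
  move: wle; rewrite ler_norml => /andP[? ?]; nra.
Qed.

Lemma config_moment_le t th left k : 0 < t ->
  (forall i, (k <= i < M)%N ->
     `|(expR th - 1) * tail_density left (t * i.+1%:R)| <= 2^-1) ->
  \sum_(w : config M K)
     expR (- t * (config_size w)%:R + th * (config_tail left k w)%:R) <=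
  expR (pi ^+ 2 / 4 / t + \sum_(k <= i < M)
    ((expR th - 1) * tail_density left (t * i.+1%:R)
     + 2 * ((expR th - 1) * tail_density left (t * i.+1%:R)) ^+ 2)).
Proof.
move=> t0 wle; rewrite config_moment.
pose g i := (expR th - 1) * tail_density left (t * i.+1%:R)
     + 2 * ((expR th - 1) * tail_density left (t * i.+1%:R)) ^+ 2.
have -> : \sum_(k <= i < M) g i = \sum_(i < M) if (k <= i)%N then g i else 0.
  have [kM|Mk] := leqP k M; last first.
    rewrite big_geq 1?ltnW// big1// => i _; case: ifP => // ki.
    by have := ltn_ord i; rewrite ltnNge (leq_trans (ltnW Mk) ki).
  rewrite -(big_mkord xpredT (fun i => if (k <= i)%N then g i else 0)).
  rewrite [RHS](@big_cat_nat _ _ _ k)//=.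
  rewrite [X in _ = X + _]big_nat_cond [X in _ = X + _]big1 ?add0r; last first.
    by move=> i /andP[/andP[_]]; rewrite ltnNge => /negbTE->.
  by apply: eq_big_nat => i /andP[-> _].
apply: (@le_trans _ _ (expR (log_gen M t + \sum_(i < M) if (k <= i)%N then g i else 0))); last first.
  by rewrite ler_expR lerD2r log_gen_le.
rewrite /log_gen -big_split/= expR_sum.
apply: ler_prod => i _.
rewrite sumr_ge0/=; last by move=> p _; rewrite mulr_ge0 ?exprn_ge0 ?expR_ge0.
have u0 : 0 < t * i.+1%:R by rewrite mulr_gt0.
have -> : expR (- t) ^+ i.+1 = expR (- (t * i.+1%:R)).
  by rewrite -expRM_natr mulNr.
case: ifP => ki.
  by rewrite addrA; apply: site_moment_le => //; apply: wle; rewrite ki/=.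
apply: (le_trans (@site_moment_le _ 0 left u0 _)).
  by rewrite expR0 subrr mul0r normr0 invr_ge0.
by rewrite expR0 subrr mul0r expr0n/= mulr0 !addr0.
Qed.

Definition partition_function t : R :=
  \sum_(w : config M K) expR (- t * (config_size w)%:R).

Lemma partition_function_le t : 0 < t ->
  partition_function t <= expR (pi ^+ 2 / 4 / t).
Proof.
move=> t0; have := @config_moment_le t 0 true M t0.
rewrite big_geq// addr0 => h.
apply: le_trans (h _); last first.
  by move=> i /andP[Mi iM]; have := leq_ltn_trans Mi iM; rewrite ltnn.
by apply: ler_sum => w _; rewrite mul0r addr0.
Qed.

Lemma prod_oneB_ge (I : finType) (f : I -> R) : (forall i, 0 <= f i <= 1) ->
  1 - \sum_i f i <= \prod_i (1 - f i).
Proof.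
move=> f01; rewrite unlock /reducebig; elim: (index_enum I) => [|i s IH]/=.
  by rewrite subr0.
have p1 : \prod_(j <- s) (1 - f j) <= 1.
  by apply: prodr_ile1 => j _; have /andP[? ?] := f01 j; lra.
rewrite unlock in p1.
have /andP[? ?] := f01 i.
move: IH p1; rewrite /reducebig; move: (foldr _ 0 _) (foldr _ 1 _) => A B; nra.
Qed.

(** The bound K on right multiplicities replaces 1 / (1 - q ^ j) by
    (1 - q ^ (j (K + 1))) / (1 - q ^ j); the union bound makes the total loss at
    most the factor 1 - M * q ^ (K + 1). *)
Lemma partition_function_ge t : 0 < t ->
  expR (log_gen M t) * (1 - M%:R * expR (- t * K.+1%:R)) <= partition_function t.
Proof.
move=> t0; rewrite /partition_function.
rewrite (eq_bigr (fun w : config M K => expR (- t * (config_size w)%:R + 0 * (config_tail true 0 w)%:R))); last first.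
  by move=> w _; rewrite mul0r addr0.
rewrite config_moment /log_gen expR_sum.
apply: (@le_trans _ _ (\prod_(i < M) expR (odd_log (expR (- t) ^+ i.+1)) *
   \prod_(i < M) (1 - (expR (- t) ^+ i.+1) ^+ K.+1))).
  apply: ler_wpM2l; first by apply: prodr_ge0 => i _; exact: expR_ge0.
  apply: le_trans (prod_oneB_ge _); last first.
    move=> i; have /andP[a b] := expRN_pow01 i t0.
    by rewrite exprn_ge0//= exprn_ile1// ltW.
  rewrite lerD2l lerN2.
  have -> : M%:R * expR (- t * K.+1%:R) = \sum_(i < M) expR (- t * K.+1%:R).
    by rewrite sumr_const card_ord mulr_natl.
  apply: ler_sum => i _; have /andP[a b] := expRN_pow01 0 t0.
  rewrite expr1 in a b.
  rewrite expRM_natr -exprM mulnC exprM [leLHS]exprS ler_piMr ?exprn_ge0//.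
  by rewrite exprn_ile1 ?exprn_ge0// exprn_ile1// ltW.
rewrite -big_split/=; apply: ler_prod => i _.
have /andP[a b] := expRN_pow01 i t0.
have u0 : 0 < t * i.+1%:R by rewrite mulr_gt0.
rewrite [X in _ <= _ <= X](sum_pair_side _ (expR 0) true) expR0 /= !mul1r.
have -> : expR (- (t * i.+1%:R)) = expR (- t) ^+ i.+1.
  by rewrite -expRM_natr mulNr.
move: (_ ^+ _) a b => x x0 x1.
have xp : 0 < 1 + x by lra.
rewrite /odd_log expRB !lnK ?posrE ?subr_gt0//.
have E : 1 - x ^+ K.+1 = (1 - x) * \sum_(i < K.+1) x ^+ i.
  by rewrite -opprB subrX1 -mulNr opprB.
rewrite mulr_ge0 ?divr_ge0 ?subr_ge0 ?exprn_ile1 ?(ltW x1) ?(ltW xp)//=.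
by rewrite E mulrA divfK// subr_eq0 gt_eqF.
Qed.

End Boltzmann.

(** * Large deviations of the tail counts *)

Section Chernoff.
Variable R : realType.

Lemma expR_le_quadratic (x : R) : `|x| <= 2^-1 -> expR x <= 1 + x + 2 * x ^+ 2.
Proof.
rewrite ler_norml => /andP[x1 x2].
have h := expR_ge1Dx (- x); have e0 := expR_gt0 x.
have e1 := expRxMexpNx_1 x.
have : expR x * (1 - x) <= expR x * expR (- x) by rewrite ler_wpM2l ?(ltW e0).
rewrite e1 => h1.
have x1' : 0 < 1 - x by lra.
rewrite -(ler_pM2r x1'); apply: (le_trans h1).
have : 0 <= x ^+ 2 * (1 - 2 * x) by rewrite mulr_ge0 ?sqr_ge0//; lra.
lra.
Qed.

Lemma expR_dist1_le (x : R) : `|x| <= 2^-1 -> `|expR x - 1| <= 2 * `|x|.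
Proof.
move=> xle; have h := expR_le_quadratic xle; have h' := expR_ge1Dx x.
move: (expR x) xle h h' => y.
case: (ger0P x) => x0 xle h h'; rewrite ler_norml; apply/andP; split.
- lra.
- have : 0 <= x * (2^-1 - x) by rewrite mulr_ge0//; lra.
  lra.
- lra.
- have : 0 <= (- x) * (2^-1 + x) by rewrite mulr_ge0//; lra.
  lra.
Qed.

Variables M K : nat.

Definition expected_tail left (t : R) k := tail_profile left (t * k.+1%:R) / t.

(** Chernoff's bound.  The sign e selects upper or lower deviations, and the
    exponent th > 0 is left free.  In the exponent, pi ^ 2 / 4 / t is the total
    mass, th * a / t the gain, and the rest the cost of tilting: second order in th
    (with r a lower bound of t k, so that the density is at most 1 / r), plus a
    term of order th, without the factor 1 / t, for replacing the exact mean S by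
    [expected_tail].  The bound does not depend on k, which allows a union bound
    over all k. *)
Lemma config_tail_deviation (e : R) left k t th r a :
  e = 1 \/ e = -1 -> 0 < t -> (k <= M)%N ->
  0 < r -> r <= t * k%:R -> 1 <= t ^+ 2 * M.+1%:R ->
  0 < th -> th <= 2^-1 -> 4 * th <= r ->
  \sum_(w : config M K | a / t < e * ((config_tail left k w)%:R - expected_tail left t k))
     expR (- t * (config_size w)%:R) <=
  expR (pi ^+ 2 / 4 / t
    + ((2 * th ^+ 2 / r + 8 * th ^+ 2 / r ^+ 2 - th * a) / t + th * (r^-1 + 1))).
Proof.
move=> e1 t0 kM r0 rk tM th0 th2 thr.
set T := expected_tail left t k.
set S := \sum_(k <= i < M) tail_density left (t * i.+1%:R).
have k0 : (0 < k)%N.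
  by rewrite lt0n; apply/eqP => k0; move: rk; rewrite k0 mulr0; lra.
have nth : `|e * th| = th.
  by case: e1 => ->; rewrite ?mul1r ?mulN1r ?normrN gtr0_norm.
have ethle : `|e * th| <= 2^-1 by rewrite nth.
have tk0 : 0 < t * k%:R := lt_le_trans r0 rk.
have tM0 : 0 < t * M.+1%:R by rewrite mulr_gt0.
have tkM : 0 < t * M%:R by rewrite mulr_gt0// ltr0n (leq_trans k0).
have k0M : (0 < k <= M)%N by rewrite k0.
have /andP[Slo Shi] := sum_tail_density_bounds left t0 k0M.
rewrite -/S in Slo Shi.
have rV : (t * k%:R)^-1 <= r^-1 by rewrite lef_pV2 ?posrE.
have /andP[_] := tail_profile_step left tk0 t0.
have -> : t * k%:R + t = t * k.+1%:R by rewrite -natr1 mulrDr mulr1.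
move=> step.
(* The two errors: one step of the profile, at most 1 / r, and the profile at
   the cutoff M, which is at most t by the assumption on M. *)
have ST : `|S - T| <= r^-1 + 1.
  rewrite ler_norml; apply/andP; split.
  - have : tail_profile left (t * M.+1%:R) / t <= 1.
      rewrite ler_pdivrMr// mul1r (le_trans (tail_profile_le left tM0))//.
      rewrite -div1r ler_pdivrMr//; move: tM; rewrite expr2 mulrA; lra.
    have : 0 < r^-1 by rewrite invr_gt0.
    move: Slo; rewrite mulrBl /T /expected_tail; lra.
  - have : (tail_profile left (t * k%:R) - tail_profile left (t * k.+1%:R)) / t <= r^-1.
      rewrite ler_pdivrMr// [leRHS]mulrC (le_trans step)// ler_wpM2l ?(ltW t0)//.
      exact: le_trans (tail_density_le left tk0) rV.
    have : 0 <= tail_profile left (t * M%:R) / t.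
      by rewrite divr_ge0 ?(ltW t0)// tail_profile_ge0.
    move: Shi; rewrite !mulrBl /T /expected_tail; lra.
have z0 i : 0 < tail_density left (t * i.+1%:R).
  by apply: tail_density_gt0; rewrite mulr_gt0.
have zr i : (k <= i)%N -> tail_density left (t * i.+1%:R) <= r^-1.
  move=> ki; have u0 : 0 < t * i.+1%:R by rewrite mulr_gt0.
  apply: (le_trans (tail_density_le left u0)); rewrite lef_pV2 ?posrE//.
  by apply: (le_trans rk); rewrite ler_pM2l// ler_nat ltnW.
have S0 : 0 <= S by apply: sumr_ge0 => i _; exact: ltW.
have SB : S <= r^-1 / t.
  apply: (le_trans Shi); rewrite ler_pM2r ?invr_gt0//.
  have : 0 <= tail_profile left (t * M%:R) by exact: tail_profile_ge0.
  have := le_trans (tail_profile_le left tk0) rV; lra.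
have w1 := expR_dist1_le ethle; rewrite nth in w1.
have w2 := expR_le_quadratic ethle.
have e2 : (e * th) ^+ 2 = th ^+ 2 by rewrite -[LHS]real_normK ?num_real// nth.
rewrite e2 in w2.
set y := expR (e * th) - 1 in w1.
have y2 : y ^+ 2 <= 4 * th ^+ 2.
  rewrite -[y ^+ 2]real_normK ?num_real//.
  have : 0 <= `|y| by []. 
  nra.
have wle i : (k <= i < M)%N -> `|y * tail_density left (t * i.+1%:R)| <= 2^-1.
  move=> /andP[/zr zi _]; rewrite normrM (gtr0_norm (z0 i)).
  have : 2 * th * r^-1 <= 2^-1 by rewrite ler_pdivrMr//; lra.
  apply: le_trans; apply: ler_pM => //; exact: ltW.
have mom := @config_moment_le R M K t (e * th) left k t0 wle.
(* Markov's inequality for the exponential of e * th * (tail - T). *)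
apply: (@le_trans _ _ (\sum_(w : config M K)
   expR (- t * (config_size w)%:R + e * th * (config_tail left k w)%:R) *
   expR (- (e * th * T) - th * a / t))).
  rewrite big_mkcond/=; apply: ler_sum => w _; case: ifP => [aw|_]; last first.
    by rewrite mulr_ge0 ?expR_ge0.
  rewrite -expRD ler_expR -subr_ge0.
  have : 0 <= th * (e * ((config_tail left k w)%:R - T) - a / t).
    by rewrite mulr_ge0 ?subr_ge0 ?ltW.
  by congr (0 <= _); ring.
rewrite -big_distrl/=; apply: (le_trans (ler_wpM2r (expR_ge0 _) mom)).
rewrite -expRD ler_expR -addrA lerD2l -/y.
rewrite big_split/= -!big_distrr/= -/S.
have Q : \sum_(k <= i < M) (y * tail_density left (t * i.+1%:R)) ^+ 2 <= 4 * th ^+ 2 * r^-1 * S.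
  rewrite /S big_distrr/=; apply: ler_sum_nat => i /andP[/zr zi _].
  rewrite exprMn [(tail_density _ _) ^+ 2]expr2 mulrA ler_wpM2r ?(ltW (z0 i))//.
  by apply: ler_pM => //; [exact: sqr_ge0|exact: ltW].
have yle : y <= e * th + 2 * th ^+ 2 by rewrite /y; lra.
have A1 : y * S <= e * th * S + 2 * th ^+ 2 * S.
  by rewrite -mulrDl ler_wpM2r.
have A2 : e * th * (S - T) <= th * (r^-1 + 1).
  by apply: (le_trans (ler_norm _)); rewrite normrM nth ler_wpM2l ?(ltW th0).
have rV0 : 0 < r^-1 by rewrite invr_gt0.
have A3 : (2 * th ^+ 2 + 8 * th ^+ 2 * r^-1) * S <= (2 * th ^+ 2 + 8 * th ^+ 2 * r^-1) * (r^-1 / t).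
  by rewrite ler_wpM2l// addr_ge0// !mulr_ge0 ?sqr_ge0// ltW.
have -> : (2 * th ^+ 2 / r + 8 * th ^+ 2 / r ^+ 2 - th * a) / t =
  (2 * th ^+ 2 + 8 * th ^+ 2 * r^-1) * (r^-1 / t) - th * a / t.
  by rewrite -exprVn; move: (r^-1) (t^-1) => rv tv; ring.
move: A1 A2 A3 Q; move: (\sum_(_ <= _ < _) _) (_ * (r^-1 / t)) => q B.
move: (r^-1) (th * a / t) => rv tv; lra.
Qed.

End Chernoff.

(** * Semi-strict sequences as configurations *)

Section Decomposition.
Implicit Types (s l r : seq nat) (m n x : nat).

Lemma geq_trans : transitive geq.
Proof. by move=> y x z /= yx zy; exact: leq_trans yx. Qed.

(** The decomposition of a semi-strict sequence around its peak m. *)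
Definition peaked l m r : bool :=
  [&& sorted ltn l, all (gtn m) l, sorted geq r, all (gtn m) r
    & all (leq 1) (l ++ m :: r)].

Lemma peaked_max l m r : peaked l m r -> (\max_(x <- l ++ m :: r) x)%N = m.
Proof.
move=> /and5P[_ /allP lm _ /allP rm _]; apply/eqP; rewrite eqn_leq; apply/andP; split.
  apply/bigmax_leqP_seq => x + _; rewrite mem_cat inE => /or3P[/lm/ltnW|/eqP->|/rm/ltnW] //.
by apply: leq_bigmax_seq; rewrite // mem_cat mem_head orbT.
Qed.

Lemma first_peak_peaked l m r : peaked l m r -> first_peak (l ++ m :: r) = size l.
Proof.
move=> pk; rewrite /first_peak (peaked_max pk); case/and5P: pk => _ /allP lm _ _ _.
rewrite index_cat /= eqxx addn0; case: ifP => // /lm /=.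
by rewrite ltnn.
Qed.

Lemma Dm_peaked n s : Dm n s ->
  exists l m r, [/\ s = l ++ m :: r, peaked l m r & sumn s = n].
Proof.
move=> [/andP[s1 _] [/existsP[k /and3P[sl mk sr]] sn]].
have ks := ltn_ord k.
exists (take k s), (nth 0%N s k), (drop k.+1 s).
have E : s = take k s ++ nth 0%N s k :: drop k.+1 s.
  by rewrite -drop_nth// cat_take_drop.
split=> //; rewrite /peaked -E s1 andbT sr /=.
move: sl; rewrite (take_nth 0%N)// !(sorted_pairwise ltn_trans) pairwise_rcons.
move=> /andP[lm ->]; rewrite lm/=.
case dE : (drop k.+1 s) sr => [//|x r'] sr.
have k1 : (k.+1 < size s)%N.
  by rewrite ltnNge; apply/negP => /drop_oversize; rewrite dE.
have xE : nth 0%N s k.+1 = x by have := drop_nth 0%N k1; rewrite dE => -[].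
rewrite xE in mk; rewrite /= mk/=.
have /allP h := order_path_min geq_trans sr.
by apply/allP => y /h /= yx; rewrite (leq_ltn_trans yx).
Qed.

Lemma peaked_Dm l m r : peaked l m r -> Dm (sumn (l ++ m :: r)) (l ++ m :: r).
Proof.
move=> /and5P[sl lm sr rm pos]; have kP : (size l < size (l ++ m :: r))%N.
  by rewrite size_cat/= addnS ltnS leq_addr.
have tk : take (size l).+1 (l ++ m :: r) = rcons l m.
  by rewrite -addn1 takeD take_size_cat// drop_size_cat//= take0 cats1.
have dk : drop (size l).+1 (l ++ m :: r) = r.
  by rewrite -add1n -drop_drop drop_size_cat//= drop0.
have slm : sorted ltn (rcons l m).
  by rewrite (sorted_pairwise ltn_trans) pairwise_rcons lm -sorted_pairwise//; exact: ltn_trans.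
have smr : sorted geq (m :: r).
  by case: r sr rm {pos kP tk dk} => //= x r -> /andP[/ltnW ->].
split; last split=> //.
- rewrite /unimodal pos/=; apply/existsP; exists (Ordinal kP) => /=.
  rewrite tk drop_size_cat// smr andbT.
  by move: slm; rewrite ltn_sorted_uniq_leq => /andP[].
- apply/existsP; exists (Ordinal kP) => /=; rewrite tk dk slm sr andbT/=.
  rewrite !nth_cat ltnn subnn subSnn (ltnNge _.+1) leqnSn/=.
  have m0 : (0 < m)%N by move: pos; rewrite all_cat => /and3P[].
  by case: (r) rm => [//|x r' /andP[]].
Qed.

Lemma sum_count_mem (F : nat -> nat) n u : all (fun x => 0 < x <= n)%N u ->
  (\sum_(i < n) count_mem i.+1 u * F i.+1 = \sum_(x <- u) F x)%N.
Proof.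
elim: u => [_|x u IH /= /andP[/andP[x0 xn] /IH {}IH]].
  by rewrite big_nil big1.
rewrite big_cons -IH; case: x x0 xn => // x _ xn.
under eq_bigr do rewrite mulnDl.
rewrite big_split/=; congr (_ + _)%N.
rewrite (bigD1 (Ordinal xn))//= eqxx mul1n big1 ?addn0// => i ix.
by rewrite eqSS eq_sym (_ : _ == _ = false) ?mul0n//; apply: negbTE.
Qed.

Definition left_part s := take (first_peak s) s.
Definition right_part s := drop (first_peak s).+1 s.

Lemma left_part_peaked l m r : peaked l m r -> left_part (l ++ m :: r) = l.
Proof. by move=> pk; rewrite /left_part (first_peak_peaked pk) take_size_cat. Qed.

Lemma right_part_peaked l m r : peaked l m r -> right_part (l ++ m :: r) = r.
Proof.
move=> pk; rewrite /right_part (first_peak_peaked pk).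
by rewrite -add1n -drop_drop drop_size_cat//= drop0.
Qed.

Definition side_part (left : bool) s := if left then left_part s else right_part s.

(** The peak is forgotten: it is n minus the sum of the other parts. *)
Definition encode n s : config n n :=
  [ffun i : 'I_n => (i.+1 \in left_part s, inord (count_mem i.+1 (right_part s)))].

Lemma Dm_parts n s : Dm n s -> [/\
  sorted ltn (left_part s), sorted geq (right_part s),
  all (fun x => 0 < x <= n)%N (left_part s),
  all (fun x => 0 < x <= n)%N (right_part s) &
  exists2 m, s = left_part s ++ m :: right_part s &
    (sumn (left_part s) + m + sumn (right_part s) = n)%N].
Proof.
case/Dm_peaked => l [m [r [-> pk sn]]].
rewrite left_part_peaked// right_part_peaked//.
case/and5P: pk => sl _ sr _ pos.
have pn : all (fun x => 0 < x <= n)%N (l ++ m :: r).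
  apply/allP => x xs; rewrite (allP pos)//= -sn.
  elim: (l ++ m :: r) xs => //= y u IH; rewrite inE => /orP[/eqP->|/IH h].
    exact: leq_addr.
  exact: leq_trans h (leq_addl _ _).
move: pn; rewrite all_cat/= => /and3P[pl _ pr]; split=> //.
by exists m => //; rewrite -sn sumn_cat/= addnA.
Qed.

Lemma count_mem_le_sumn x u : (0 < x)%N -> (count_mem x u <= sumn u)%N.
Proof.
move=> x0; elim: u => //= y u IH; apply: leq_add => //.
by case: eqP => // ->.
Qed.

Lemma encode_right n s (i : 'I_n) : Dm n s ->
  ((encode n s i).2 : nat) = count_mem i.+1 (right_part s).
Proof.
case/Dm_parts => _ _ _ _ [m _ sn]; rewrite ffunE/= inordK//.
by rewrite ltnS (leq_trans (count_mem_le_sumn _ _))// -sn leq_addl.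
Qed.

Lemma encode_left n s (i : 'I_n) : Dm n s ->
  ((encode n s i).1 : nat) = count_mem i.+1 (left_part s).
Proof.
case/Dm_parts => sl _ _ _ _; rewrite ffunE/= count_uniq_mem//.
exact: (sorted_uniq ltn_trans ltnn).
Qed.

Lemma encode_side left n s (i : 'I_n) : Dm n s ->
  side_mult left (encode n s i) = count_mem i.+1 (side_part left s).
Proof. by case: left; [exact: encode_left|exact: encode_right]. Qed.

Lemma encode_tail left k n s : Dm n s ->
  config_tail left k (encode n s) = count (fun x => k < x)%N (side_part left s).
Proof.
move=> sD; rewrite /config_tail big_mkcond/=.
have pn : all (fun x => 0 < x <= n)%N (side_part left s).
  by case: left; case: (Dm_parts sD).
rewrite -sum1_count [RHS]big_mkcond/=.
rewrite -[RHS](sum_count_mem (fun x => if (k < x)%N then 1 else 0)%N pn).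
apply: eq_bigr => i _; rewrite ltnS; case: ifP; rewrite ?muln0// muln1 => _.
exact: encode_side.
Qed.

Lemma encode_size n s : Dm n s -> (config_size (encode n s) <= n)%N.
Proof.
move=> sD; have [_ _ pl pr [m _ sn]] := Dm_parts sD.
have -> : config_size (encode n s) = (sumn (left_part s) + sumn (right_part s))%N.
  rewrite !sumnE -(sum_count_mem id pl) -(sum_count_mem id pr) -big_split/=.
  by apply: eq_bigr => i _; rewrite encode_left// encode_right// mulnDr ![(i.+1 * _)%N]mulnC.
by rewrite -[leqRHS]sn -addnA leq_add2l leq_addl.
Qed.

Lemma eq_count_mem_in n u v :
  all (fun x => 0 < x <= n)%N u -> all (fun x => 0 < x <= n)%N v ->
  (forall i : 'I_n, count_mem i.+1 u = count_mem i.+1 v) -> perm_eq u v.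
Proof.
move=> /allP un /allP vn h; apply/allP => x; rewrite mem_cat => xuv.
have : (0 < x <= n)%N by case/orP: xuv => [/un|/vn].
by case: x {xuv} => // x /= xn; rewrite (h (Ordinal xn)).
Qed.

(** Each side is sorted, so its multiplicities determine it. *)
Lemma encode_inj n s s' : Dm n s -> Dm n s' -> encode n s = encode n s' -> s = s'.
Proof.
move=> sD sD' E.
have [sl sr pl pr [m sE sn]] := Dm_parts sD.
have [sl' sr' pl' pr' [m' sE' sn']] := Dm_parts sD'.
have El : left_part s = left_part s'.
  apply: (irr_sorted_eq ltn_trans ltnn) => //; apply: perm_mem.
  by apply: (eq_count_mem_in pl pl') => i; rewrite -!encode_left// E.
have Er : right_part s = right_part s'.
  apply: (sorted_eq geq_trans) => //; first by move=> x y; rewrite /= andbC => /anti_leq.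
  by apply: (eq_count_mem_in pr pr') => i; rewrite -!encode_right// E.
rewrite sE sE' El Er; congr (_ ++ _ :: _).
by move: sn sn'; rewrite El Er => <- /eqP; rewrite eqn_add2r eqn_add2l => /eqP.
Qed.

End Decomposition.

(** * Configurations as semi-strict sequences *)

Section Decode.
Variables (M K n : nat).
Implicit Types (w : config M K).

Definition decode_left w : seq nat :=
  sort leq [seq (nat_of_ord i).+1 | i <- enum 'I_M & (w i).1].

Definition decode_right w : seq nat :=
  sort geq (flatten [seq nseq (w i).2 (nat_of_ord i).+1 | i <- enum 'I_M]).

(** The peak receives the mass missing from the configuration; it exceeds all
    other parts as soon as [config_size w + M < n]. *)
Definition decode w : seq nat :=
  decode_left w ++ (n - config_size w)%N :: decode_right w.

Lemma mem_decode_left w (i : 'I_M) : (i.+1 \in decode_left w) = (w i).1.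
Proof.
rewrite mem_sort; apply/mapP/idP => [[j]|wi].
  by rewrite mem_filter => /andP[wj _] [/val_inj->].
by exists i => //; rewrite mem_filter wi mem_enum.
Qed.

Lemma count_decode_right w (i : 'I_M) : count_mem i.+1 (decode_right w) = (w i).2.
Proof.
rewrite count_sort count_flatten -map_comp sumnE big_map big_enum/=.
rewrite (bigD1 i)//= count_nseq/= eqxx mul1n big1 ?addn0// => j ji.
by rewrite count_nseq/= eqSS (_ : _ == _ = false) ?mul0n//; apply: negbTE.
Qed.

Lemma decode_left_le w x : x \in decode_left w -> (0 < x <= M)%N.
Proof. by rewrite mem_sort => /mapP[i _ ->] /=; exact: ltn_ord. Qed.

Lemma decode_right_le w x : x \in decode_right w -> (0 < x <= M)%N.
Proof.
rewrite mem_sort => /flattenP[u /mapP[i _ ->]].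
by rewrite mem_nseq => /andP[_ /eqP->]; exact: ltn_ord.
Qed.

Lemma sumn_decode_left w : sumn (decode_left w) = (\sum_(i < M) i.+1 * (w i).1)%N.
Proof.
rewrite (perm_sumn (permEl (perm_sort _ _))) sumnE big_map big_filter big_enum_cond/=.
by rewrite big_mkcond; apply: eq_bigr => i _; case: (w i).1; rewrite ?muln1 ?muln0.
Qed.

Lemma sumn_decode_right w : sumn (decode_right w) = (\sum_(i < M) i.+1 * (w i).2)%N.
Proof.
rewrite (perm_sumn (permEl (perm_sort _ _))) sumn_flatten -map_comp sumnE big_map big_enum/=.
by apply: eq_bigr => i _; rewrite sumn_nseq.
Qed.

Lemma decode_peaked w : (config_size w + M < n)%N ->
  peaked (decode_left w) (n - config_size w) (decode_right w).
Proof.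
move=> wn; have Mm : (M < n - config_size w)%N by rewrite ltn_subRL.
apply/and5P; split.
- rewrite ltn_sorted_uniq_leq sort_uniq sort_sorted ?andbT; last exact: leq_total.
  by rewrite map_inj_uniq ?filter_uniq -?enumT ?enum_uniq// => i j [/val_inj].
- by apply/allP => x /decode_left_le/andP[_ /leq_ltn_trans]; exact.
- by apply: sort_sorted => x y; exact: leq_total.
- by apply/allP => x /decode_right_le/andP[_ /leq_ltn_trans]; exact.
- rewrite all_cat/= (leq_ltn_trans _ Mm)// andTb; apply/andP; split; apply/allP => x.
    by case/decode_left_le/andP.
  by case/decode_right_le/andP.
Qed.

Lemma sumn_decode w : (config_size w + M < n)%N -> sumn (decode w) = n.
Proof.
move=> wn; rewrite sumn_cat/= sumn_decode_left sumn_decode_right addnCA -big_split/=.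
rewrite (eq_bigr (fun i : 'I_M => i.+1 * ((w i).1 + (w i).2))%N); last first.
  by move=> i _; rewrite mulnDr.
by rewrite subnK// ltnW// (leq_ltn_trans _ wn)// leq_addr.
Qed.

Lemma decode_Dm w : (config_size w + M < n)%N -> Dm n (decode w).
Proof. by move=> wn; have := peaked_Dm (decode_peaked wn); rewrite sumn_decode. Qed.

Lemma decode_inj w w' : (config_size w + M < n)%N -> (config_size w' + M < n)%N ->
  decode w = decode w' -> w = w'.
Proof.
move=> wn wn' E.
have El : decode_left w = decode_left w'.
  by rewrite -(left_part_peaked (decode_peaked wn)) -(left_part_peaked (decode_peaked wn')) -!/(decode _) E.
have Er : decode_right w = decode_right w'.
  by rewrite -(right_part_peaked (decode_peaked wn)) -(right_part_peaked (decode_peaked wn')) -!/(decode _) E.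
apply/ffunP => i; rewrite [LHS]surjective_pairing [RHS]surjective_pairing; congr (_, _).
  by rewrite -!mem_decode_left El.
by apply: val_inj; rewrite /= -!count_decode_right Er.
Qed.

End Decode.

Lemma card_set_ge (T : finType) (A : set (seq nat)) (P : pred T) (g : T -> seq nat) :
  finite_set A -> (forall w, P w -> A (g w)) ->
  {in P &, injective g} -> (#|P| <= card_set A)%N.
Proof.
move=> fA PA ginj; rewrite /card_set cardE.
rewrite -(size_map g).
have : uniq [seq g w | w <- enum P].
  rewrite map_inj_in_uniq ?enum_uniq// => x y.
  by rewrite !mem_enum; exact: ginj.
move/uniq_leq_size; apply => s /mapP[w]; rewrite mem_enum => /PA Aw ->.
by rewrite in_fset_set ?inE.
Qed.

Lemma card_set_le (T : finType) (A : set (seq nat)) (P : pred T) (f : seq nat -> T) :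
  finite_set A -> (forall s, A s -> P (f s)) ->
  (forall s s', A s -> A s' -> f s = f s' -> s = s') -> (card_set A <= #|P|)%N.
Proof.
move=> fA PA finj; rewrite /card_set cardE -(size_map f).
have : uniq [seq f s | s <- enum_fset (fset_set A)].
  rewrite map_inj_in_uniq ?fset_uniq// => x y.
  by rewrite !in_fset_set// !inE; exact: finj.
move/uniq_leq_size; apply => s /mapP[w]; rewrite in_fset_set// inE => /PA Aw ->.
by rewrite mem_enum.
Qed.

Lemma dm_ge M K n : (#|[pred w : config M K | config_size w + M < n]| <= dm n)%N.
Proof.
apply: (@card_set_ge _ _ _ (decode n)); first exact: finite_Dm.
- by move=> w; exact: decode_Dm.
- by move=> w w'; rewrite !inE; exact: decode_inj.
Qed.

Lemma card_Dm_le n (A : set (seq nat)) (P : pred (config n n)) :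
  (forall s, Dm n s -> A s -> P (encode n s)) ->
  (card_set [set s | Dm n s /\ A s] <=
     #|[pred w : config n n | (config_size w <= n)%N && P w]|)%N.
Proof.
move=> AP; apply: (@card_set_le _ _ _ (encode n)).
- by apply: sub_finite_set (finite_Dm n) => s [].
- by move=> s [sD sA]; rewrite inE/= encode_size// AP.
- by move=> s s' [sD _] [sD' _]; exact: encode_inj.
Qed.

Lemma card_set_setC n (A : set (seq nat)) :
  (card_set [set s | Dm n s /\ A s] + card_set [set s | Dm n s /\ ~ A s] = dm n)%N.
Proof.
have fD := finite_Dm n.
have f1 : finite_set [set s | Dm n s /\ A s] by apply: sub_finite_set fD => s [].
have f2 : finite_set [set s | Dm n s /\ ~ A s] by apply: sub_finite_set fD => s [].
rewrite /dm /card_set.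
have E : Dm n = [set s | Dm n s /\ A s] `|` [set s | Dm n s /\ ~ A s].
  apply/seteqP; split => s /=; last by case=> -[].
  by move=> sD; have [?|?] := pselect (A s); [left|right].
rewrite [in RHS]E fset_setU// cardfsU.
rewrite (_ : (_ `&` _)%fset = fset0) ?cardfs0 ?subn0//.
apply/fsetP => s; rewrite in_fsetI in_fset0 !in_fset_set//; apply/negbTE.
by apply/andP => -[]; rewrite !inE/= => -[_ As] [_].
Qed.

(** * The lower bound on dm *)

Section LowerBound.
Variable R : realType.

(** Configurations of size below Y, resp. above X, carry a weight bounded by
    changing t into t + s, resp. t - s; the others number at most the cardinal on
    the right and weigh at most exp(- t Y) each. *)
Lemma card_size_le_two_sided M K (t s X Y : R) : 0 <= s -> 0 <= t ->
  partition_function M K t - expR (s * Y) * partition_function M K (t + s)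
     - expR (- (s * X)) * partition_function M K (t - s) <=
  expR (- (t * Y)) *
    #|[pred w : config M K | (config_size w)%:R <= X]|%:R.
Proof.
move=> s0 t0; rewrite !lerBlDr /partition_function !big_distrr/=.
rewrite -sum1_card natr_sum big_distrr/= [X in _ <= X + _ + _]big_mkcond/=.
rewrite -!big_split/=; apply: ler_sum => w _; rewrite inE/=.
set S := (config_size w)%:R; rewrite -!expRD.
have h0 (x : R) := expR_ge0 x.
have [SY|YS] := ltP S Y.
  apply: (@le_trans _ _ (expR (s * Y + - (t + s) * S))).
    rewrite ler_expR -subr_ge0.
    have : 0 <= s * (Y - S) by rewrite mulr_ge0// subr_ge0 ltW.
    by congr (0 <= _); ring.
  by case: ifP => _; rewrite ?mulr1 ?add0r ?lerDr ?lerDl ?addr_ge0// -addrA addrCA lerDl addr_ge0.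
have [SX|XS] := leP S X.
  rewrite mulr1 -addrA; apply: (@le_trans _ _ (expR (- (t * Y)))).
    by rewrite ler_expR mulNr lerN2 ler_wpM2l.
  by rewrite lerDl addr_ge0.
rewrite add0r; apply: (@le_trans _ _ (expR (- (s * X) + - (t - s) * S))).
  rewrite ler_expR -subr_ge0.
  have : 0 <= s * (S - X) by rewrite mulr_ge0// subr_ge0 ltW.
  by congr (0 <= _); ring.
by rewrite lerDl.
Qed.

(** The window X, Y = (1 +- 2 b) c / t is centred at the typical size c / t, and
    the shift is s = b t.  Since log Z(t') is about c t / t', each of the two tails
    loses at least a factor exp(- b ^ 2 c / 2) against the whole. *)
Lemma card_size_le_ge M K (t b : R) : 0 < t -> 0 < b -> b <= 4^-1 ->
  let c := pi ^+ 2 / 4 / t in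
  2 <= b ^+ 2 / 4 * c ->
  expR ((1 - b ^+ 2 / 4) * c) <= partition_function M K t ->
  expR ((2 - 3 * b) * c) <=
  #|[pred w : config M K | (config_size w)%:R <= (1 + 2 * b) * c / t]|%:R.
Proof.
move=> t0 b0 b4 c c2 W.
have p0 : 0 < pi ^+ 2 / 4 :> R by rewrite divr_gt0// exprn_gt0// pi_gt0.
have c0 : 0 < c by rewrite divr_gt0.
have tn0 : t != 0 by rewrite gt_eqF.
have bt0 : 0 < b * t by rewrite mulr_gt0.
have := @card_size_le_two_sided M K t (b * t) ((1 + 2 * b) * c / t) ((1 - 2 * b) * c / t) (ltW bt0) (ltW t0).
have -> : b * t * ((1 - 2 * b) * c / t) = b * (1 - 2 * b) * c by field.
have -> : b * t * ((1 + 2 * b) * c / t) = b * (1 + 2 * b) * c by field.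
have -> : t * ((1 - 2 * b) * c / t) = (1 - 2 * b) * c by field.
have cE (x : R) : 0 < x -> pi ^+ 2 / 4 / (x * t) = c / x.
  by move=> x0; rewrite /c; field; rewrite tn0 gt_eqF.
have U1 : partition_function M K (t + b * t) <= expR (c / (1 + b)).
  have E : t + b * t = (1 + b) * t by ring.
  have h : 0 < 1 + b by lra.
  by rewrite E -cE//; apply: partition_function_le; rewrite mulr_gt0.
have U2 : partition_function M K (t - b * t) <= expR (c / (1 - b)).
  have E : t - b * t = (1 - b) * t by ring.
  have h : 0 < 1 - b by lra.
  by rewrite E -cE//; apply: partition_function_le; rewrite mulr_gt0.
set q := (1 - b ^+ 2 / 2) * c.
have V1 : expR (b * (1 - 2 * b) * c) * partition_function M K (t + b * t) <= expR q.
  apply: (le_trans (ler_wpM2l (expR_ge0 _) U1)); rewrite -expRD ler_expR.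
  rewrite [c / _]mulrC -mulrDl ler_pM2r//.
  have h : (1 + b)^-1 <= 1 - b + b ^+ 2.
    rewrite -div1r ler_pdivrMr; last by lra.
    have : 0 <= b ^+ 3 by rewrite exprn_ge0// ltW.
    lra.
  nra.
have V2 : expR (- (b * (1 + 2 * b) * c)) * partition_function M K (t - b * t) <= expR q.
  apply: (le_trans (ler_wpM2l (expR_ge0 _) U2)); rewrite -expRD ler_expR.
  rewrite [c / _]mulrC -mulNr -mulrDl ler_pM2r//.
  have h : (1 - b)^-1 <= 1 + b + 3 / 2 * b ^+ 2.
    rewrite -div1r ler_pdivrMr; last by lra.
    have : 0 <= b ^+ 2 * (1 - 3 * b) by rewrite mulr_ge0 ?sqr_ge0//; lra.
    lra.
  lra.
have W3 : 3 * expR q <= partition_function M K t.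
  apply: le_trans W.
  have -> : (1 - b ^+ 2 / 4) * c = b ^+ 2 / 4 * c + q by rewrite /q; field.
  rewrite expRD ler_wpM2r ?expR_ge0//.
  by apply: le_trans (expR_ge1Dx _); lra.
set N := #|_|%:R.
move=> h.
have {}h : expR q <= expR (- ((1 - 2 * b) * c)) * N by apply: le_trans h; lra.
apply: (@le_trans _ _ (expR ((1 - 2 * b) * c + q))).
  rewrite ler_expR /q -mulrDl ler_pM2r//; nra.
by rewrite expRD -ler_pdivlMl ?expR_gt0// -expRN.
Qed.

Lemma truncn_bounds (x : R) : 0 <= x -> (Num.truncn x)%:R <= x < (Num.truncn x)%:R + 1.
Proof. by move=> x0; have /andP[? ?] := truncn_itv x0; rewrite natr1; apply/andP. Qed.

(** For t of order 1 / sqrt n and sizes cut at b n, neither cutoff matters to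
    first order: the weight is at least exp((1 - b ^ 2 / 4) c), where exp c is the
    upper bound of [partition_function_le]. *)
Lemma partition_function_typical (b : R) : 0 < b -> b <= 4^-1 ->
  exists A : R, forall (n : nat) (a x t c : R),
    n%:R = x ^+ 2 -> 1 <= a -> a <= 3 -> A <= x -> t = a / x ->
    c = pi ^+ 2 / 4 / t ->
    [/\ 0 < t, 2 <= b ^+ 2 / 4 * c &
     expR ((1 - b ^+ 2 / 4) * c) <=
       partition_function (Num.truncn (b * n%:R)) n t].
Proof.
move=> b0 b4; have pi2 := pi_ge2 R.
have [C CE] : exists C, C = pi ^+ 2 / 4 :> R by exists (pi ^+ 2 / 4).
rewrite -CE; have C1 : 1 <= C by rewrite CE ler_pdivlMr//; nra.
have C0 : 0 < C := lt_le_trans ltr01 C1.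
have b20 : 0 < b ^+ 2 by rewrite exprn_gt0.
have b21 : b ^+ 2 <= 1 by rewrite expr2; nra.
have [K0 hK0] : exists K0, C * (1 - b ^+ 2 / 32) <= 2 * \sum_(k < K0) (k.*2.+1)%:R ^- 2.
  have e0 : 0 < C * (b ^+ 2 / 64) by rewrite mulr_gt0// divr_gt0.
  have [K0 h] := sum_inv_odd2_ge e0; exists K0.
  apply: (@le_trans _ _ (2 * (pi ^+ 2 / 8 - C * (b ^+ 2 / 64)))); last by rewrite ler_pM2l.
  by rewrite CE; lra.
(* In turn: exp x >= 2 x ^ 2 bounds the loss from the multiplicities, exp(- t M)
   is at most b ^ 2 / 32, the error 2 K0 of [log_gen_ge] is at most
   b ^ 2 c / 16, and constant factors are absorbed. *)
exists (12 + (32 / b ^+ 2 + 3) / b + 96 * K0%:R / b ^+ 2 + 24 / b ^+ 2).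
move=> n a x t c nE a1 a3 Ax tE cE.
have T1 : 0 <= (32 / b ^+ 2 + 3) / b by rewrite divr_ge0 ?(ltW b0)// addr_ge0// divr_ge0// ltW.
have T2 : 0 <= 96 * K0%:R / b ^+ 2 by rewrite divr_ge0 ?(ltW b20)// mulr_ge0.
have T3 : 0 <= 24 / b ^+ 2 by rewrite divr_ge0 ?(ltW b20).
have x12 : 12 <= x by lra.
have A1 : 32 / b ^+ 2 + 3 <= x * b by rewrite -ler_pdivrMr//; lra.
have A2 : 96 * K0%:R <= x * b ^+ 2 by rewrite -ler_pdivrMr//; lra.
have A3 : 24 <= x * b ^+ 2 by rewrite -ler_pdivrMr//; lra.
have x0 : 0 < x by lra.
have an0 : 0 < a by lra.
have t0 : 0 < t by rewrite tE divr_gt0.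
have cx : x / 3 <= c.
  rewrite cE ler_pdivlMr// tE.
  have -> : x / 3 * (a / x) = a / 3 by field; rewrite gt_eqF.
  lra.
have bc y : 0 < y -> b ^+ 2 / y * (x / 3) <= b ^+ 2 / y * c.
  by move=> y0; rewrite ler_pM2l// divr_gt0.
have /andP[M1 M2] : (Num.truncn (b * n%:R))%:R <= b * n%:R < (Num.truncn (b * n%:R))%:R + 1.
  by apply: truncn_bounds; rewrite mulr_ge0// ltW.
move: (Num.truncn _) M1 M2 => M; rewrite nE => M1 M2.
clear Ax T1 T2 T3.
have e1 : expR (- t * M%:R) <= b ^+ 2 / 32.
  have tM : x * b - 3 <= t * M%:R.
    apply: (@le_trans _ _ (t * (b * x ^+ 2 - 1))); last by rewrite ler_pM2l//; lra.
    have -> : t * (b * x ^+ 2 - 1) = a * (b * x) - a / x.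
      by rewrite tE; field; rewrite gt_eqF.
    have : a / x <= 3 by rewrite ler_pdivrMr//; lra.
    have : b * x <= a * (b * x) by rewrite ler_peMl// ltW// mulr_gt0.
    lra.
  rewrite mulNr expRN -[leRHS]invrK lef_pV2 ?posrE ?expR_gt0 ?invr_gt0 ?divr_gt0//.
  by apply: le_trans (expR_ge1Dx _); rewrite invf_div; lra.
have e2 : M%:R * expR (- t * n.+1%:R) <= 2^-1.
  have xM : M%:R <= x ^+ 2 by rewrite (le_trans M1)// ler_piMl ?sqr_ge0//; lra.
  have xt : x <= t * n.+1%:R.
    apply: (@le_trans _ _ (t * n%:R)); last by rewrite ler_pM2l// ler_nat.
    rewrite nE tE.
    have -> : a / x * x ^+ 2 = a * x by field; rewrite gt_eqF.
    by rewrite ler_peMl// ltW.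
  have ex : 2 * x ^+ 2 <= expR x.
    have := @expR_ge1Dxn R x 2 (ltW x0).
    rewrite (_ : 3`!%:R = 6 :> R)//.
    have : 0 <= x ^+ 2 * (x - 12) by rewrite mulr_ge0 ?sqr_ge0// subr_ge0.
    lra.
  apply: (@le_trans _ _ (x ^+ 2 * expR (- x))).
    by apply: ler_pM; rewrite ?expR_ge0//; rewrite ler_expR mulNr lerN2.
  by rewrite expRN ler_pdivrMr ?expR_gt0//; lra.
have LG : (1 - b ^+ 2 / 8) * c <= log_gen M t.
  apply: le_trans (@log_gen_ge R M K0 t t0).
  have hA : C * (1 - b ^+ 2 / 32) * (1 - b ^+ 2 / 32) / t <=
      2 * (\sum_(k < K0) k.*2.+1%:R ^- 2) * (1 - expR (- t * M%:R)) / t.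
    rewrite ler_pM2r ?invr_gt0//; apply: ler_pM => //; last by lra.
      by rewrite mulr_ge0 ?(ltW C0)//; lra.
    lra.
  have hB : 2 * K0%:R <= b ^+ 2 / 16 * c by apply: le_trans (bc 16 _); lra.
  have hC : (1 - b ^+ 2 / 16) * c <= C * (1 - b ^+ 2 / 32) * (1 - b ^+ 2 / 32) / t.
    have -> : C * (1 - b ^+ 2 / 32) * (1 - b ^+ 2 / 32) / t =
        (1 - b ^+ 2 / 16 + (b ^+ 2 / 32) ^+ 2) * c.
      by rewrite cE; field; rewrite gt_eqF.
    by rewrite ler_pM2r ?lerDl ?sqr_ge0// cE divr_gt0.
  lra.
split=> //; first by apply: le_trans (bc 4 _); lra.
apply: le_trans (@partition_function_ge R M n t t0).
have -> : (1 - b ^+ 2 / 4) * c = (1 - b ^+ 2 / 8) * c - b ^+ 2 / 8 * c by field.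
rewrite expRD; apply: ler_pM; rewrite ?expR_ge0 ?ler_expR//.
have h : 1 <= b ^+ 2 / 8 * c by apply: le_trans (bc 8 _); lra.
have : expR (- (b ^+ 2 / 8 * c)) <= 2^-1.
  by rewrite expRN lef_pV2 ?posrE ?expR_gt0//; apply: le_trans (expR_ge1Dx _); lra.
lra.
Qed.

(** Sizes at most M = b n leave room for a peak, and t = (1 + 2 b) pi / (2 sqrt n)
    puts the window of [card_size_le_ge] just below n.  Up to factors in the
    exponent that tend to 1 as b tends to 0, the count is then
    exp(2 * pi ^ 2 / (4 t)) = exp(pi sqrt n). *)
Lemma dm_lower (d : R) : 0 < d -> exists A : R, forall n,
  A <= Num.sqrt n%:R -> expR ((pi - d) * Num.sqrt n%:R) <= (dm n)%:R :> R.
Proof.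
move=> d0; have pi2 := pi_ge2 R; have pi4 : pi < 4 :> R by have := pihalf_lt2 R; lra.
have [b [b0 b4 bd]] : exists b : R, [/\ 0 < b, b <= 4^-1 & b <= d / 16].
  exists (Num.min 4^-1 (d / 16)).
  by rewrite lt_min invr_gt0 ltr0n/= divr_gt0// !ge_min !lexx orbT; split.
have [A H] := partition_function_typical b0 b4.
exists (1 + `|A|) => n.
have nE : n%:R = Num.sqrt n%:R ^+ 2 :> R by rewrite sqr_sqrtr.
move: (Num.sqrt _) nE => x nE Ax.
have [x0 Ax'] : 0 < x /\ A <= x.
  by have := ler_norm A; have := normr_ge0 A; split; lra.
have [h0 h1] : 0 < 1 + 2 * b /\ 1 + 2 * b <= 3 / 2 by split; lra.
have [a aE] : exists a, a = (1 + 2 * b) * (pi / 2) :> R by eexists.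
have a1 : 1 <= a by rewrite aE; nra.
have a3 : a <= 3 by rewrite aE; nra.
have [t0 c2 W] := H n a x _ _ nE a1 a3 Ax' erefl erefl.
have /andP[+ _] := @truncn_bounds (b * n%:R) (mulr_ge0 (ltW b0) (ler0n _ _)).
move: (Num.truncn _) W => M W M1.
have := card_size_le_ge t0 b0 b4 c2 W.
have pin0 : pi != 0 :> R by rewrite gt_eqF// pi_gt0.
have -> : pi ^+ 2 / 4 / (a / x) = pi * x / (2 * (1 + 2 * b)).
  by rewrite aE; move: (pi) pin0 => p p0; field; rewrite p0 !gt_eqF.
have -> : (1 + 2 * b) * (pi * x / (2 * (1 + 2 * b))) / (a / x) = x ^+ 2 / (1 + 2 * b).
  by rewrite aE; move: (pi) pin0 => p p0; field; rewrite p0 !gt_eqF.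
move=> h; apply: le_trans (le_trans h _).
- rewrite ler_expR.
  have hb : 1 - 2 * b <= (1 + 2 * b)^-1 by rewrite -div1r ler_pdivlMr//; nra.
  have -> : (2 - 3 * b) * (pi * x / (2 * (1 + 2 * b))) =
     pi * x * ((1 - 3 / 2 * b) * (1 + 2 * b)^-1) by field; rewrite gt_eqF.
  apply: (@le_trans _ _ (pi * x * (1 - 4 * b))).
    have : 0 <= (4 - pi) * (b * x) by rewrite !mulr_ge0 ?(ltW b0) ?(ltW x0)//; lra.
    have : 0 <= (d / 16 - b) * x by rewrite mulr_ge0 ?(ltW x0)//; lra.
    lra.
  rewrite ler_pM2l; last by rewrite mulr_gt0// pi_gt0.
  apply: (@le_trans _ _ ((1 - 3 / 2 * b) * (1 - 2 * b))); first by nra.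
  by rewrite ler_pM2l//; lra.
rewrite ler_nat; apply: leq_trans (dm_ge M n n).
apply/subset_leq_card/fintype.subsetP => w; rewrite !inE/= => wx.
rewrite -(ltr_nat R) natrD; apply: (le_lt_trans (lerD wx M1)).
rewrite nE -subr_gt0.
have -> : x ^+ 2 - (x ^+ 2 / (1 + 2 * b) + b * x ^+ 2) =
   x ^+ 2 * b * (1 - 2 * b) / (1 + 2 * b) by field; rewrite gt_eqF.
by rewrite divr_gt0// mulr_gt0 ?mulr_gt0 ?exprn_gt0//; lra.
Qed.

End LowerBound.

(** * The border of the diagram *)

Section Shape.
Variable R : realType.
Implicit Types (l r s u v : seq nat) (m n k h : nat) (p : R * R).

Lemma cat_eq_cat (T : Type) (u v u' v' : seq T) : u ++ v = u' ++ v' ->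
  (exists w, u' = u ++ w /\ v = w ++ v') \/ (exists w, u = u' ++ w /\ v' = w ++ v).
Proof.
elim: u u' => [|x u IH] [|x' u'] /=.
- by move=> ->; left; exists [::].
- by move=> ->; left; exists (x' :: u').
- by move=> <-; right; exists (x :: u).
- by move=> [-> /IH[[w [-> ->]]|[w [-> ->]]]]; [left|right]; exists w.
Qed.

(** A point of the border lies on a vertical segment, which cuts the sequence
    between two columns, or on the top of a column.  The default 0 of [last] and
    [head] accounts for the two vertical segments ending on the axis. *)
Lemma polyline_border p a h0 s : polyline (a, h0%:R) (border_vertices a s) p ->
  (exists s1 s2 (t : R), [/\ s = s1 ++ s2, 0 <= t <= 1, p.1 = a + (size s1)%:R &
      p.2 = (1 - t) * (last h0 s1)%:R + t * (head 0%N s2)%:R]) \/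
  (exists s1 h s2, [/\ s = s1 ++ h :: s2, p.2 = h%:R &
      a + (size s1)%:R <= p.1 <= a + (size s1)%:R + 1]).
Proof.
elim: s a h0 => [|h s IH] a h0 /=.
  move=> [[t]|->]; last first.
    left; exists [::], [::], 1; split=> //=; first by rewrite ler01 lexx.
      by rewrite addr0.
    by rewrite subrr mul0r mulr0 addr0.
  rewrite /= in_itv/= => t01 <-; left; exists [::], [::], t; split=> //=.
  by rewrite addr0; ring.
move=> [[t]|[[t]|/IH[]]].
- rewrite /= in_itv/= => t01 <-; left; exists [::], (h :: s), t; split=> //=.
  by rewrite addr0; ring.
- rewrite /= in_itv/= => /andP[t0 t1] <-; right; exists [::], h, s; split=> //=; first by ring.
  by rewrite addr0; apply/andP; split; lra.
- move=> [s1 [s2 [t [-> t01 e1 e2]]]]; left; exists (h :: s1), s2, t; split=> //=.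
  by rewrite e1 -natr1; ring.
- move=> [s1 [h' [s2 [-> e2 e1]]]]; right; exists (h :: s1), h', s2; split=> //=.
  by move: e1; rewrite -natr1; lra.
Qed.

Lemma count_eq0_le k u : all (geq k) u -> count (ltn k) u = 0%N.
Proof.
move=> /allP uk; apply/eqP; rewrite eqn0Ngt -has_count; apply/hasPn => x /uk /=.
by rewrite -leqNgt.
Qed.

Lemma count_size_lt k u : all (ltn k) u -> count (ltn k) u = size u.
Proof. by move=> h; apply/eqP; rewrite -all_count. Qed.

Lemma sorted_ltn_cat u v : sorted ltn (u ++ v) ->
  all (geq (last 0%N u)) u /\ forall m, all (leq (head m v)) v.
Proof.
move=> /cat_sorted2[su sv]; split.
  case/lastP: u su => // u x su; rewrite last_rcons all_rcons /= leqnn/=.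
  move: su; rewrite (sorted_pairwise ltn_trans) pairwise_rcons => /andP[+ _].
  by apply: sub_all => y /ltnW.
case: v sv => //= x v sv _; rewrite leqnn/=.
by apply: sub_all (order_path_min ltn_trans sv) => y /ltnW.
Qed.

Lemma sorted_geq_cat u v : sorted geq (u ++ v) ->
  (forall m, all (leq (last m u)) u) /\ all (geq (head 0%N v)) v.
Proof.
move=> /cat_sorted2[su sv]; split.
  move=> m; case/lastP: u su => // u x su; rewrite last_rcons all_rcons /= leqnn/=.
  by move: su; rewrite (sorted_pairwise geq_trans) pairwise_rcons => /andP[+ _].
by case: v sv => //= x v sv; rewrite leqnn/=; exact: (order_path_min geq_trans sv).
Qed.

Definition side_sign (left : bool) : R := if left then -1 else 1.

Lemma last_le_head u m v : sorted leq (u ++ rcons v m) -> (last 0 u <= head m v)%N.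
Proof.
move=> suv; have : path leq 0 (u ++ rcons v m) by move: suv; case: (u ++ _).
by rewrite cat_path => /andP[_]; case: v {suv} => [|x v] /= /andP[].
Qed.

Lemma head_le_last u m v : sorted geq (m :: u ++ v) -> (head 0 v <= last m u)%N.
Proof. by rewrite /= cat_path => /andP[_]; case: v => //= x v /andP[]. Qed.

Lemma convex_bounds (x y t : R) : x <= y -> 0 <= t -> t <= 1 ->
  x <= (1 - t) * x + t * y <= y.
Proof. by move=> xy t0 t1; apply/andP; split; nra. Qed.

(** At height y, the border is at a horizontal distance from the axis lying
    between the number of parts greater than y and the number of parts at least y
    on the same side, up to the unit width of the peak on the right.  As y lies
    in [k + 1, k + 2), these numbers are estimated by the parts greater than k + 1
    and the parts greater than k. *)
Lemma shape_between_tails n s p k : Dm n s -> Defs.shape s p ->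
  k.+1%:R <= p.2 < k.+2%:R ->
  exists left, (count (ltn k.+1) (side_part left s))%:R <= side_sign left * p.1
    <= (count (ltn k) (side_part left s))%:R + 1.
Proof.
case/Dm_peaked => l [m [r [-> pk sn]]].
rewrite /Defs.shape (first_peak_peaked pk) => sp /andP[k1 k2].
have lE := left_part_peaked pk; have rE := right_part_peaked pk.
case/and5P: pk => sl lm sr rm pos.
(* The border cuts the left part into l1 and l2, resp. the right part into r1
   and r2, with all outer columns below and all inner columns above height y. *)
have goL l1 l2 : l = l1 ++ l2 -> all (geq k.+1) l1 -> all (ltn k) l2 ->
    (size l2)%:R <= - p.1 <= (size l2)%:R + 1 -> exists left,
    (count (ltn k.+1) (side_part left (l ++ m :: r)))%:R <= side_sign left * p.1
    <= (count (ltn k) (side_part left (l ++ m :: r)))%:R + 1.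
  move=> lC l1k l2k /andP[px1 px2]; exists true.
  rewrite /= lE lC !count_cat (count_eq0_le l1k) (count_size_lt l2k) add0n mulN1r.
  rewrite (le_trans _ px1) ?ler_nat ?count_size//=.
  by rewrite (le_trans px2)// natrD lerD2r lerDr.
have goR r1 r2 : r = r1 ++ r2 -> all (ltn k) r1 -> all (geq k.+1) r2 ->
    (size r1)%:R <= p.1 <= (size r1)%:R + 1 -> exists left,
    (count (ltn k.+1) (side_part left (l ++ m :: r)))%:R <= side_sign left * p.1
    <= (count (ltn k) (side_part left (l ++ m :: r)))%:R + 1.
  move=> rC r1k r2k /andP[px1 px2]; exists false.
  rewrite /= rE rC !count_cat (count_eq0_le r2k) (count_size_lt r1k) addn0 mul1r.
  rewrite (le_trans _ px1) ?ler_nat ?count_size//=.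
  by rewrite (le_trans px2)// natrD lerD2r lerDl.
have leqk x h : (x <= h)%N -> h%:R <= p.2 -> (x <= k.+1)%N.
  by move=> xh hy; rewrite -ltnS -(ltr_nat R); apply: le_lt_trans k2; apply: le_trans hy; rewrite ler_nat.
have ltnk x h : (h <= x)%N -> p.2 <= h%:R -> (k < x)%N.
  by move=> xh hy; rewrite -(ler_nat R); apply: (le_trans k1); apply: (le_trans hy); rewrite ler_nat.
have slm : sorted ltn (rcons l m).
  by rewrite (sorted_pairwise ltn_trans) pairwise_rcons lm -sorted_pairwise//; exact: ltn_trans.
have smr : sorted geq (m :: r).
  by case: (r) sr rm => //= x r' -> /andP[/ltnW ->].
have caseL s1 w t : l = s1 ++ w -> 0 <= t -> t <= 1 -> p.1 = - (size l)%:R + (size s1)%:R ->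
    p.2 = (1 - t) * (last 0 s1)%:R + t * (head m w)%:R -> exists left,
    (count (ltn k.+1) (side_part left (l ++ m :: r)))%:R <= side_sign left * p.1
    <= (count (ltn k) (side_part left (l ++ m :: r)))%:R + 1.
  move=> lC t0 t1 px py; rewrite lC in slm.
  have sw := slm; rewrite -cats1 -catA cats1 in sw.
  have lh : (last 0 s1)%:R <= (head m w)%:R :> R.
    rewrite ler_nat; apply: last_le_head.
    by move: sw; rewrite ltn_sorted_uniq_leq => /andP[].
  have /andP[y1 y2] := convex_bounds lh t0 t1; rewrite -py in y1 y2.
  have [/allP h1 _] := sorted_ltn_cat sw.
  rewrite lC in sl; have [_ /(_ m)/allP h2] := sorted_ltn_cat sl.
  apply: (goL s1 w lC).
  - by apply/allP => x /h1 xs; apply: leqk y1.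
  - by apply/allP => x /h2 xs; apply: ltnk y2.
  - have -> : - p.1 = (size w)%:R by rewrite px lC size_cat natrD; ring.
    by rewrite lexx lerDl ler01.
have caseR r1 r2 t : r = r1 ++ r2 -> 0 <= t -> t <= 1 -> p.1 = (size r1)%:R + 1 ->
    p.2 = (1 - t) * (last m r1)%:R + t * (head 0 r2)%:R -> exists left,
    (count (ltn k.+1) (side_part left (l ++ m :: r)))%:R <= side_sign left * p.1
    <= (count (ltn k) (side_part left (l ++ m :: r)))%:R + 1.
  move=> rC t0 t1 px py; rewrite rC in smr sr.
  have lh : (head 0 r2)%:R <= (last m r1)%:R :> R by rewrite ler_nat; exact: head_le_last.
  have t0' : 0 <= 1 - t by lra.
  have t1' : 1 - t <= 1 by lra.
  have /andP[y1 y2] := convex_bounds lh t0' t1'.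
  rewrite (_ : 1 - (1 - t) = t) in y1 y2; last by ring.
  rewrite addrC -py in y1 y2.
  have [/(_ m)/allP h1 /allP h2] := sorted_geq_cat sr.
  apply: (goR r1 r2 rC).
  - by apply/allP => x /h1 xs; apply: ltnk y2.
  - by apply/allP => x /h2 xs; apply: leqk y1.
  - by rewrite px lexx andbT lerDl ler01.
have [[s1 [s2 [t [sE /andP[t0 t1] px py]]]]|] := @polyline_border p _ 0%N _ sp.
- case: (cat_eq_cat sE) => [[[|m' r1] [s1E mrE]]|[w [lC s2E]]].
  + apply: (caseL s1 [::] t) => //; first by rewrite s1E !cats0.
    by move: mrE => /= mrE; rewrite py -mrE.
  + case: mrE => mE rC; rewrite -mE in s1E.
    apply: (caseR r1 s2 t) => //; last by rewrite py s1E last_cat.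
    by rewrite px s1E size_cat/= natrD -natr1; ring.
  + by apply: (caseL s1 w t) => //; rewrite py s2E; case: (w).
- move=> [s1 [h [s2 [sE py px]]]].
  have py1 : h%:R <= p.2 by rewrite py.
  have py2 : p.2 <= h%:R by rewrite py.
  case: (cat_eq_cat sE) => [[[|m' r1] [s1E mrE]]|[w [lC s2E]]].
  + case: mrE => mE rC; apply: (goR [::] r) => //=.
      by apply: sub_all rm => x /= xm; apply: leqk py1; rewrite -mE ltnW.
    by move: px; rewrite s1E cats0 addNr.
  + case: mrE => mE rC; rewrite -mE in s1E.
    have rC' : r = rcons r1 h ++ s2 by rewrite cat_rcons.
    have [/(_ m)/allP h1 _] : (forall m0, all (leq (last m0 (rcons r1 h))) (rcons r1 h)) /\ all (geq (head 0%N s2)) s2.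
      by apply: sorted_geq_cat; rewrite -rC'.
    have [_ /allP h2] : (forall m0, all (leq (last m0 r1)) r1) /\ all (geq (head 0%N (h :: s2))) (h :: s2).
      by apply: sorted_geq_cat; rewrite -rC.
    apply: (goR (rcons r1 h) s2 rC').
    * by apply/allP => x /h1; rewrite last_rcons => xs; apply: ltnk py2.
    * by apply/allP => x xs; apply: leqk py1; apply: h2; rewrite inE xs orbT.
    * move: px; rewrite s1E size_cat/= size_rcons natrD -!natr1 => /andP[? ?].
      by apply/andP; split; lra.
  + case: w lC s2E => [|h' l2] lC [hE s2E].
      apply: (goR [::] r) => //=.
        by apply: sub_all rm => x /= xm; apply: leqk py1; rewrite hE ltnW.
      by move: px; rewrite lC cats0 addNr.
    rewrite -hE {h' hE} in lC.
    have lC' : l = rcons s1 h ++ l2 by rewrite cat_rcons.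
    have sl' := sl; rewrite lC' in sl'; have [/allP h1 _] := sorted_ltn_cat sl'.
    have sl'' := sl; rewrite lC in sl''; have [_ /(_ m)/allP h2] := sorted_ltn_cat sl''.
    apply: (goL (rcons s1 h) l2 lC').
    * by apply/allP => x /h1; rewrite last_rcons => xs; apply: leqk py1.
    * by apply/allP => x xs; apply: ltnk py2; apply: h2; rewrite inE xs orbT.
    * move: px; rewrite lC size_cat/= natrD -natr1 => /andP[? ?].
      by apply/andP; split; lra.
Qed.

End Shape.

(** * The limit shape *)

Section Final.
Variable R : realType.
Implicit Types (eps x y t a r v : R) (n k : nat) (s : seq nat).

Lemma tail_profile_le_mono left (u v : R) : 0 < u -> u <= v ->
  tail_profile left v <= tail_profile left u.
Proof.
move=> u0 uv; have v0 := lt_le_trans u0 uv.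
have := tail_profile_tangent left v0 u0.
have : 0 <= (v - u) * tail_density left v.
  by rewrite mulr_ge0 ?subr_ge0// ltW// tail_density_gt0.
lra.
Qed.

(** Both branches of the curve are inverse to a rescaled [tail_profile]. *)
Lemma fdm_tail_profile left v : 0 < v ->
  let x0 := side_sign R left * (2 / pi) * tail_profile left (pi / 2 * v) in
  @fdm_dom R x0 /\ fdm x0 = v.
Proof.
move=> v0; have pi0 := pi_gt0 R.
have pin0 : pi != 0 :> R by rewrite gt_eqF.
have c0 : 0 < 2 / pi :> R by rewrite divr_gt0.
have u0 : 0 < pi / 2 * v by rewrite mulr_gt0// divr_gt0.
set u := pi / 2 * v in u0 *.
have E0 := expR_gt0 (- u).
have E1 : expR (- u) < 1 by rewrite expR_lt1 oppr_lt0.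
have cancel_pi (q e z : R) : q != 0 -> - (q / 2) * (e * (2 / q) * z) = - e * z.
  by move=> q0; field.
have vE : 2 / pi * u = v by rewrite /u -[pi / 2]invf_div mulVKf// gt_eqF.
case: left => /=.
- have l0 : 0 < ln (1 + expR (- u)) by apply: ln_gt0; lra.
  have x00 : -1 * (2 / pi) * ln (1 + expR (- u)) < 0.
    by rewrite mulN1r mulNr oppr_lt0 mulr_gt0.
  split.
    left; rewrite /= in_itv/= x00 andbT mulN1r !mulNr lerN2 ler_pM2l// ler_ln ?posrE; lra.
  rewrite /fdm x00.
  have -> : - (pi / 2) * (-1 * (2 / pi) * ln (1 + expR (- u))) = ln (1 + expR (- u)).
    by rewrite cancel_pi// opprK mul1r.
  by rewrite lnK ?posrE ?addr_gt0// addrC addKr expRK mulrNN.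
- have l0 : 0 < - ln (1 - expR (- u)) by rewrite oppr_gt0 ln_lt0; lra.
  have x00 : 0 < 1 * (2 / pi) * - ln (1 - expR (- u)).
    by rewrite mul1r mulr_gt0.
  split; first by right; rewrite /= in_itv/= x00.
  rewrite /fdm ltNge (ltW x00)/=.
  have -> : - (pi / 2) * (1 * (2 / pi) * - ln (1 - expR (- u))) = ln (1 - expR (- u)).
    by rewrite cancel_pi// mulrN mulNr opprK mul1r.
  by rewrite lnK ?posrE ?subr_gt0// opprB addrC subrK expRK mulrNN.
Qed.

Lemma shape_height n s (p : R * R) : Dm n s -> Defs.shape s p -> 0 <= p.2 <= n%:R.
Proof.
move=> [_ [_ sn]] sp.
have le_n u w : s = u ++ w -> (last 0 u <= n)%N /\ (head 0 w <= n)%N.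
  move=> sE; rewrite -sn sE sumn_cat; split.
    case/lastP: u {sE} => // u y; rewrite last_rcons sumn_rcons; lia.
  case: w {sE} => //= y w; lia.
have [[s1 [s2 [t [sE /andP[t0 t1] _ ->]]]]|[s1 [h [s2 [sE -> _]]]]] :=
    @polyline_border R p _ 0%N _ sp.
- have [] := le_n _ _ sE; rewrite -!(ler_nat R).
  have : 0 <= (last 0 s1)%:R :> R by [].
  have : 0 <= (head 0 s2)%:R :> R by [].
  move: (_%:R) (_%:R) (_%:R) => X Y Z *; apply/andP; split; nra.
- have [_] := le_n _ _ sE; rewrite -(ler_nat R) /= => ->.
  by rewrite ler0n.
Qed.

(** If both tail counts are close to their expected values at all integer heights
    above r / t, monotonicity in the height extends this to all real heights, at
    the cost of one step of the profile; [shape_between_tails] concludes.  Lower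
    points are near the horizontal axis. *)
Lemma shape_in_Nbhd n s eps x t a r : Dm n s ->
  0 < eps -> 0 < r -> 0 < t -> x = Num.sqrt n%:R -> t * x = pi / 2 ->
  2 <= eps * x -> r <= t * (eps * x - 2) ->
  a / t + r^-1 + 1 <= eps * x ->
  (forall left k, (k <= n)%N -> r <= t * k%:R ->
     `|(count (ltn k) (side_part left s))%:R - expected_tail left t k| <= a / t) ->
  renormalized_shape s `<=` Nbhd eps (@fdm_dom R) (@fdm R).
Proof.
move=> sD eps0 r0 t0 xE tx ex2 rt ax H _ [p sp <-].
have sn : sumn s = n by case: sD => _ [].
rewrite sn -xE; rewrite /Nbhd/=.
have ex0 : 0 < eps * x by lra.
have x0 : 0 < x by rewrite -(pmulr_rgt0 _ eps0).
have /andP[y0 yn] := shape_height sD sp.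
have [yl|yl] := leP `|p.2 / x| eps; first by right; left.
left; rewrite ger0_norm ?divr_ge0 ?(ltW x0)// ltr_pdivlMr// in yl.
set y := p.2 in y0 yn yl *.
have yp : 0 < y by lra.
have /andP[k1 k2] := truncn_bounds y0.
have : (0 < Num.truncn y)%N.
  rewrite lt0n; apply/eqP => e; move: k2; rewrite e; lra.
case kE : (Num.truncn y) k1 k2 => [//|k] k1 k2 _.
have kn : (k.+1 <= n)%N by rewrite -(ler_nat R) (le_trans k1).
rewrite natr1 in k2.
have rk : r <= t * k%:R.
  apply: (le_trans rt); rewrite ler_pM2l//; move: k2; rewrite -!natr1; lra.
have rk1 : r <= t * k.+1%:R.
  by apply: (le_trans rk); rewrite ler_pM2l// ler_nat.
have kb : k.+1%:R <= p.2 < k.+2%:R by apply/andP; split.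
have [left /andP[X1 X2]] := shape_between_tails sD sp kb.
have := H left k (ltnW kn) rk; have := H left k.+1 kn rk1.
rewrite !ler_norml => /andP[h1 _] /andP[_ h2].
pose T := tail_profile left (t * y) / t.
have tk0 : 0 < t * k.+1%:R by rewrite mulr_gt0.
have T1 : T <= expected_tail left t k.
  rewrite /T /expected_tail ler_pM2r ?invr_gt0//.
  by apply: tail_profile_le_mono => //; rewrite ler_pM2l.
have T2 : expected_tail left t k.+1 <= T.
  rewrite /T /expected_tail ler_pM2r ?invr_gt0//.
  by apply: tail_profile_le_mono; rewrite ?mulr_gt0// ler_pM2l// ltW.
have T3 : expected_tail left t k - expected_tail left t k.+1 <= r^-1.
  rewrite /expected_tail -mulrBl ler_pdivrMr//.
  have /andP[_] := tail_profile_step left tk0 t0.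
  have -> : t * k.+1%:R + t = t * k.+2%:R by rewrite -[k.+2%:R]natr1 mulrDr mulr1.
  move=> /le_trans; apply; rewrite mulrC ler_pM2r//.
  by apply: (le_trans (tail_density_le left tk0)); rewrite lef_pV2 ?posrE.
have v0 : 0 < y / x by rewrite divr_gt0.
have [D0 f0] := fdm_tail_profile left v0.
exists (side_sign R left * (2 / pi) * tail_profile left (pi / 2 * (y / x))); split => //.
have -> : side_sign R left * (2 / pi) * tail_profile left (pi / 2 * (y / x)) =
    side_sign R left * (T / x).
  rewrite /T -tx; have -> : t * x * (y / x) = t * y by field; rewrite gt_eqF.
  have -> : pi = 2 * (t * x) by rewrite tx; field.
  by field; rewrite !gt_eqF.
have sg : side_sign R left * side_sign R left = 1.
  by case: left {X1 X2 h1 h2 T T1 T2 T3 D0 f0} => /=; rewrite ?mulrNN mul1r.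
have -> : side_sign R left * (T / x) - p.1 / x = side_sign R left * ((T - side_sign R left * p.1) / x).
  by rewrite mulrBl mulrBr !mulrA sg mul1r.
rewrite normrM (_ : `|side_sign R left| = 1); last first.
  by case: (left) => /=; rewrite ?normrN normr1.
rewrite mul1r normrM normfV (gtr0_norm x0) ler_pdivrMr//.
rewrite ler_norml; apply/andP; split; lra.
Qed.

(** The index q lists the side, the sign of the deviation and the height; the
    signs are (-1) ^+ false = 1 and (-1) ^+ true = -1. *)
Definition deviates n t a r (q : bool * bool * 'I_n.+1) : pred (config n n) := fun w =>
  (r <= t * q.2%:R) && (a / t <
    (-1) ^+ q.1.2 * ((config_tail q.1.1 q.2 w)%:R - expected_tail q.1.1 t q.2)).

(** A union bound over q, after the size constraint has been replaced by the
    factor exp(t (n - size)), at least 1 on sizes at most n. *)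
Lemma card_deviates_le n t a r B : 0 < t ->
  (forall q, \sum_(w : config n n | deviates t a r q w) expR (- t * (config_size w)%:R) <= B) ->
  #|[pred w : config n n | (config_size w <= n)%N && [exists q, deviates t a r q w]]|%:R
  <= (4 * n.+1)%:R * (expR (t * n%:R) * B).
Proof.
move=> t0 H.
rewrite -sum1_card natr_sum big_mkcond/=.
apply: (@le_trans _ _ (\sum_(w : config n n) \sum_(q : bool * bool * 'I_n.+1)
    if deviates t a r q w then expR (t * n%:R) * expR (- t * (config_size w)%:R) else 0)).
  apply: ler_sum => w _; have g0 q : 0 <= if deviates t a r q w
      then expR (t * n%:R) * expR (- t * (config_size w)%:R) else 0.
    by case: ifP => // _; rewrite mulr_ge0 ?expR_ge0.
  case: ifP; last by rewrite sumr_ge0.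
  rewrite inE => /andP[wn /existsP[q wq]].
  rewrite (bigD1 q)//= wq; apply: ler_wpDr; first by rewrite sumr_ge0.
  rewrite -expRD mulNr -mulrBr; apply: le_trans (expR_ge1Dx _).
  by rewrite lerDl mulr_ge0 ?(ltW t0)// subr_ge0 ler_nat.
rewrite exchange_big/=.
have -> : (4 * n.+1)%:R * (expR (t * n%:R) * B) =
    \sum_(q : bool * bool * 'I_n.+1) (expR (t * n%:R) * B).
  by rewrite sumr_const !card_prod card_bool card_ord mulr_natl.
apply: ler_sum => q _; rewrite -big_mkcond/= -big_distrr/=.
by rewrite ler_wpM2l ?expR_ge0.
Qed.

(** With t = pi / (2 sqrt n), both t n and pi ^ 2 / (4 t) equal pi sqrt n / 2.
    The exponent th is chosen small enough, in terms of eps only, for the second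
    order cost in [config_tail_deviation] to be at most half of the gain
    th * r / t, which leaves a saving of order sqrt n. *)
Lemma card_outside_le eps : 0 < eps -> exists A B d : R, 0 < d /\
  forall n, A <= Num.sqrt n%:R ->
  (card_set [set s | Dm n s /\
     ~ (renormalized_shape s `<=` Nbhd eps (@fdm_dom R) (@fdm R))])%:R
  <= (4 * n.+1)%:R * expR ((pi - 2 * d) * Num.sqrt n%:R + B) :> R.
Proof.
move=> eps0; have pi0 := pi_gt0 R; have pi2 := pi_ge2 R.
have [r rE] : exists r, r = pi * eps / 4 :> R by exists (pi * eps / 4).
have r0 : 0 < r by rewrite rE divr_gt0 ?mulr_gt0.
have r2 : 0 < r ^+ 2 by rewrite exprn_gt0.
have rV0 : 0 < r^-1 by rewrite invr_gt0.
pose g : R := 2 / r + 8 / r ^+ 2.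
have g0 : 0 < g by rewrite addr_gt0 ?divr_gt0.
pose th : R := Num.min (Num.min 2^-1 (r / 4)) (r / 2 / g).
have th0 : 0 < th by rewrite !lt_min invr_gt0 ltr0n/= !divr_gt0.
have th1 : th <= 2^-1 by rewrite !ge_min lexx.
have th2 : th <= r / 4 by rewrite !ge_min lexx !orbT.
have th3 : th * g <= r / 2 by rewrite -ler_pdivlMr// !ge_min lexx !orbT.
(* The term 4 / eps keeps the height index above r / t after two roundings; the
   next one makes the errors r^-1 + 1 smaller than eps * sqrt n / 2. *)
exists (1 + 4 / eps + (r^-1 + 1) * 2 / eps), (r^-1 + 1), (th * r / (2 * pi)).
split; first by rewrite divr_gt0 ?mulr_gt0.
move=> n; set x := Num.sqrt n%:R => Ax.
have Q1 : 0 < 4 / eps by rewrite divr_gt0.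
have Q2 : 0 < (r^-1 + 1) * 2 / eps by rewrite divr_gt0 ?mulr_gt0 ?addr_gt0.
have x1 : 1 <= x by lra.
have x0 : 0 < x by lra.
have ex4 : 4 <= eps * x by rewrite mulrC -ler_pdivrMr//; lra.
have ex2 : (r^-1 + 1) * 2 <= eps * x by rewrite mulrC [leRHS]mulrC -ler_pdivrMr// mulrC; lra.
have nE : n%:R = x ^+ 2 by rewrite sqr_sqrtr.
pose t := pi / 2 / x.
have t0 : 0 < t by rewrite !divr_gt0.
have tx : t * x = pi / 2 by rewrite divfK// gt_eqF.
have tn : t * n%:R = pi / 2 * x by rewrite nE expr2 mulrA tx.
have rt : r / t = eps * x / 2.
  by rewrite rE /t; move: (pi) pi0 => q q0; field; rewrite !gt_eqF.
have ct : pi ^+ 2 / 4 / t = pi / 2 * x.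
  by rewrite /t; move: (pi) pi0 => q q0; field; rewrite !gt_eqF.
pose D := expR (pi ^+ 2 / 4 / t
    + ((2 * th ^+ 2 / r + 8 * th ^+ 2 / r ^+ 2 - th * r) / t + th * (r^-1 + 1))).
have devD q : \sum_(w : config n n | deviates t r r q w) expR (- t * (config_size w)%:R) <= D.
  have [rk|rk] := leP r (t * q.2%:R); last first.
    by rewrite big_pred0 ?expR_ge0// => w; rewrite /deviates leNgt rk.
  rewrite (eq_bigl (fun w => r / t <
    (-1) ^+ q.1.2 * ((config_tail q.1.1 q.2 w)%:R - expected_tail q.1.1 t q.2))); last first.
    by move=> w; rewrite /deviates rk.
  apply: config_tail_deviation => //.
  - by case: q.1.2; [right|left].
  - by rewrite -ltnS.
  - rewrite expr2 -natr1 mulrDr mulr1.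
    have : 1 <= t * t * n%:R by rewrite -mulrA tn mulrCA [t * _]mulrC -mulrA; nra.
    by have := mulr_gt0 t0 t0; lra.
  - lra.
have W := card_deviates_le t0 devD.
have {}W : #|[pred w : config n n | (config_size w <= n)%N && [exists q, deviates t r r q w]]|%:R
   <= (4 * n.+1)%:R * expR ((pi - 2 * (th * r / (2 * pi))) * x + (r^-1 + 1)).
  apply: (le_trans W); rewrite ler_pM2l ?ltr0n// -expRD ler_expR tn ct.
  have -> : 2 * th ^+ 2 / r + 8 * th ^+ 2 / r ^+ 2 - th * r = th * (th * g - r).
    by rewrite /g; field; rewrite gt_eqF.
  have h1 : th * (th * g - r) / t <= th * (- (r / 2)) / t.
    by rewrite ler_pM2r ?invr_gt0// ler_pM2l//; lra.
  have h2 : th * (- (r / 2)) / t = - (2 * (th * r / (2 * pi)) * x).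
    by rewrite /t; move: (pi) pi0 => q q0; field; rewrite !gt_eqF.
  have h3 : th * (r^-1 + 1) <= r^-1 + 1 by rewrite ler_piMl ?addr_ge0 ?(ltW rV0)//; lra.
  lra.
apply: le_trans W; rewrite ler_nat.
apply: (card_Dm_le (A := fun s => ~ (renormalized_shape s `<=` Nbhd eps (@fdm_dom R) (@fdm R)))).
move=> s sD; apply: contra_notT => /existsPn nd.
apply: (@shape_in_Nbhd n s eps x t r r) => //.
- lra.
- have -> : t * (eps * x - 2) = pi / 2 * eps - 2 * t by rewrite mulrBr mulrCA tx; ring.
  have : 2 * t <= pi / 4 * eps.
    rewrite /t -[2 * _]mulrCA.
    have : x^-1 <= eps / 4 by rewrite -[leRHS]invf_div lef_pV2 ?posrE ?divr_gt0// ler_pdivrMr// mulrC.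
    nra.
  rewrite rE; lra.
- rewrite rt; lra.
move=> left k kn rk; rewrite -(encode_tail left k sD).
have P (pos : bool) : (-1) ^+ pos * ((config_tail left k (encode n s))%:R - expected_tail left t k) <= r / t.
  have := nd (left, pos, @Ordinal n.+1 k kn).
  by rewrite /deviates/= rk/= -leNgt.
rewrite ler_norml; apply/andP; split.
- by have := P true; rewrite expr1 mulN1r; lra.
- by have := P false; rewrite expr0 mul1r.
Qed.

Lemma near_sqrt_ge A : \forall n \near \oo, A <= Num.sqrt n%:R :> R.
Proof.
near=> n; have : A ^+ 2 <= n%:R by near: n; exact: nbhs_infty_ger.
move=> h; apply: (le_trans (ler_norm A)).
by rewrite -sqrtr_sqr ler_wsqrtr.
Unshelve. all: by end_near. Qed.

End Final.

Theorem theorem1p3 (R : realType) (eps : R) (eps_gt0 : 0 < eps) :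
  (fun n : nat =>
     (dm n)%:R^-1 *
     (card_set [set s | Dm n s /\
        renormalized_shape s `<=` Nbhd eps (@fdm_dom R) (@fdm R)])%:R : R)
    @ \oo --> (1 : R).
Proof.
have [A [B [d [d0 upper]]]] := card_outside_le eps_gt0.
have [A' lower] := dm_lower d0.
apply/cvgrPdist_le => e e0.
near=> n.
have Ax : A <= Num.sqrt n%:R by near: n; exact: near_sqrt_ge.
have Ax' : A' <= Num.sqrt n%:R by near: n; exact: near_sqrt_ge.
have x1 : 1 <= Num.sqrt n%:R :> R by near: n; exact: near_sqrt_ge.
have xe : 48 * expR B / (d ^+ 3 * e) <= Num.sqrt n%:R by near: n; exact: near_sqrt_ge.
have up := upper n Ax; have lo := lower n Ax'.
set x : R := Num.sqrt n%:R in x1 xe up lo *.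
have x0 : 0 < x by lra.
have nE : n%:R = x ^+ 2 by rewrite sqr_sqrtr.
have dm0 : 0 < (dm n)%:R :> R := lt_le_trans (expR_gt0 _) lo.
set P := fun s => renormalized_shape s `<=` Nbhd eps (@fdm_dom R) (@fdm R).
have := card_set_setC n P; set G := card_set _; set N := card_set _ => GN.
rewrite -/N in up.
have -> : 1 - (dm n)%:R^-1 * G%:R = N%:R / (dm n)%:R :> R.
  have -> : G%:R = (dm n)%:R - N%:R :> R by rewrite -GN natrD addrK.
  by rewrite mulrBr mulVf ?gt_eqF// opprB addrC subrK mulrC.
rewrite ger0_norm ?divr_ge0// ler_pdivrMr//.
apply: (le_trans up); apply: (@le_trans _ _ (e * expR ((pi - d) * x))); last by rewrite ler_pM2l.
have -> : (pi - 2 * d) * x + B = (pi - d) * x + (B - d * x) by ring.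
rewrite expRD mulrCA [leRHS]mulrC ler_pM2l ?expR_gt0// expRB.
rewrite mulrA ler_pdivrMr ?expR_gt0//.
have n8 : (4 * n.+1)%:R <= 8 * x ^+ 2 :> R.
  by rewrite natrM -[n.+1%:R]natr1 nE; nra.
apply: (@le_trans _ _ (8 * x ^+ 2 * expR B)); first by rewrite ler_pM2r ?expR_gt0.
have dx0 : 0 <= d * x by rewrite mulr_ge0 ?ltW.
(* The cubic term of exp(d x) beats the factor n = x ^ 2. *)
have := @expR_ge1Dxn R (d * x) 2 dx0; rewrite (_ : 3`!%:R = 6 :> R)// => ex.
have {}ex : (d * x) ^+ 3 / 6 <= expR (d * x) by lra.
apply: (@le_trans _ _ (e * ((d * x) ^+ 3 / 6))); last by rewrite ler_pM2l.
rewrite ler_pdivrMr ?mulr_gt0 ?exprn_gt0// in xe.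
have : 0 <= x ^+ 2 * (x * (d ^+ 3 * e) - 48 * expR B).
  by rewrite mulr_ge0 ?sqr_ge0// subr_ge0.
rewrite exprMn; lra.
Unshelve. all: by end_near. Qed.
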